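(* Assume that $1<p<\infty$ and $p\ne2$, and let $U\colon R_\omega^p\to R_\omega^p$ be a surjective linear isometry, where $R_\omega^p=\widehat{X}_\omega$. Then there exist $\varepsilon\in\{-1,1\}$ and, for every $k\in\mathbb{N}$, a bijection $\varphi_k\colon\Omega_k\to\Omega_k$ such that $$U\left(c\mathbf{1}+\sum_{k=1}^{\infty}J_kf_k\right)=\varepsilon c\mathbf{1}+\varepsilon\sum_{k=1}^{\infty}J_k(f_k\circ\varphi_k)$$ for every $c\in\mathbb{R}$ and every canonical exterior decomposition $\sum_{k=1}^{\infty}J_kf_k\in X_\omega$.
   Context: All function spaces are real and $\mathbb{N}=\{1,2,\dots\}$. For $n\in\mathbb{N}$, $\Omega_n=\{0,1\}^n$ carries the uniform probability measure $\mu_n$ (on its power set), and $H_n=\{f\in L^p(\Omega_n,\mu_n):\int_{\Omega_n}f\,d\mu_n=0\}$. Let $(\Omega,\Sigma,\mu)=\prod_{n=1}^\infty(\Omega_n,\mathcal{P}(\Omega_n),\mu_n)$ be the product probability space, $\pi_n\colon\Omega\to\Omega_n$ the $n$-th coordinate projection, and $J_n\colon L^p(\Omega_n,\mu_n)\to L^p(\Omega,\mu)$, $J_nf=f\circ\pi_n$. Let $X_\omega$ be the closure in $L^p(\Omega)$ of $\operatorname{span}\{J_n(H_n):n\in\mathbb{N}\}$, and $\widehat{X}_\omega=\mathbb{R}\mathbf{1}\oplus X_\omega\subseteq L^p(\Omega)$ its unitalization, with the $L^p(\Omega)$ norm. The first limit Bourgain--Rosenthal--Schechtman space $R_\omega^p$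 is identified with $\widehat{X}_\omega$. Every $x\in X_\omega$ has a unique representation $x=\sum_{n=1}^\infty J_nf_n$ with $f_n\in H_n$ and convergence in $L^p(\Omega)$, called its canonical exterior decomposition. *)

(* Defs.v *)
From HB Require Import structures.
From mathcomp Require Import all_boot all_order all_algebra.
From mathcomp Require Import all_classical all_reals all_analysis.
From mathcomp Require Import ess_sup_inf measurable_realfun.
Set Implicit Arguments.
Unset Strict Implicit.
Unset Printing Implicit Defensive.
Import Order.TTheory GRing.Theory Num.Theory numFieldNormedType.Exports.
Local Open Scope classical_set_scope.
Local Open Scope ring_scope.

(* The library defines the type [LspaceType mu p1] of a.e.-classes of functions
   with finite L^p norm, but equips it with no algebraic structure.  Here it is
   made a normed module: [Lclass] is the class of an L^p function, [Lrepr] a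
   representative of a class, and the operations and the norm are those of
   representatives. *)
Section Lspace_normed_module.
Context d (T : measurableType d) (R : realType).
Variables (mu : {measure set T -> \bar R}) (p : \bar R) (p1 : (1 <= p)%E).
Local Notation Lfun_t := (LfunType mu p1).
Local Notation Lp := (LspaceType mu p1).
Local Notation aeMfun := {mfun_ mu, T >-> measurableTypeR R}.

Lemma ae_eq_Lnorm (f g : {mfun T >-> R}) : f = g %[ae mu] ->
  ('N[mu]_p[EFin \o f] = 'N[mu]_p[EFin \o g])%E.
Proof.
move=> fg; rewrite unlock.
case: p p1 => [r|//|//] r1.
  have mpow (h : {mfun T >-> R}) :
      measurable_fun setT (fun x => (`|(EFin \o h) x| `^ r)%E).
    apply: (measurableT_comp (measurable_poweR r)).
    by apply: measurableT_comp => //; exact/measurable_EFinP.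
  congr (_ `^ _)%E; apply: ae_eq_integral => //.
  by apply: filterS fg => x /= fgx xT; rewrite fgx.
case: ifPn => // _; apply: eq_ess_sup.
by apply: filterS fg => x fgx /=; rewrite (fgx I).
Qed.

Lemma Lspace_repr_subproof (f : Lp) :
  (repr (f : aeMfun) : T -> R) \in Lfun mu p.
Proof.
apply/andP; split; rewrite inE/=; last by case: f => f [[]].
exact: (measurable_funPT (repr (f : aeMfun))).
Qed.

Definition Lrepr (f : Lp) : Lfun_t := Lfun_Sub p1 (Lspace_repr_subproof f).

Definition Lfun_mfun (f : Lfun_t) : {mfun T >-> measurableTypeR R} :=
  HB.pack (f : T -> measurableTypeR R)
    (isMeasurableFun.Build _ _ T (measurableTypeR R) f (measurable_funPT f)).

Lemma repr_pi_ae (f : {mfun T >-> measurableTypeR R}) :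
  repr (\pi_aeMfun%qT f) = f %[ae mu].
Proof.
have /eqmodP/asboolP : repr (\pi_aeMfun%qT f) = f %[mod aeMfun]%qT.
  by rewrite reprK.
exact.
Qed.

Definition ae_class (f : {mfun T >-> measurableTypeR R}) : aeMfun :=
  (\pi_aeMfun f)%qT.

Lemma Lclass_subproof (f : Lfun_t) :
   finite_norm mu p (ae_class (Lfun_mfun f)).
Proof.
pose f' : {mfun T >-> R} := HB.pack (ae_class (Lfun_mfun f) : T -> R)
  (isMeasurableFun.Build _ _ T R _
    (measurable_funPT (repr (ae_class (Lfun_mfun f))))).
rewrite /finite_norm (@ae_eq_Lnorm f' f); first exact: Lfunction_finite.
exact: (repr_pi_ae (Lfun_mfun f)).
Qed.

Definition Lclass (f : Lfun_t) : Lp :=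
  HB.pack (ae_class (Lfun_mfun f))
    (isFinLebesgue.Build d T R mu p p1 _ (Lclass_subproof f)).

Lemma Lrepr_class (f : Lfun_t) : Lrepr (Lclass f) = f %[ae mu].
Proof. exact: (repr_pi_ae (Lfun_mfun f)). Qed.

Lemma Lspace_eqP (f g : Lp) : Lrepr f = Lrepr g %[ae mu] -> f = g.
Proof.
case: f g => [f [[Pf]]] [g [[Pg]]] /= fg.
have /eqP eqfg : f == g.
  rewrite -[f]reprK -[g]reprK. apply/eqP/eqmodP/asboolP. exact: fg.
rewrite {fg}eqfg in Pf *.
by rewrite (Prop_irrelevance Pf Pg).
Qed.

Lemma Lclass_repr (f : Lp) : Lclass (Lrepr f) = f.
Proof. exact/Lspace_eqP/Lrepr_class. Qed.

Lemma Lclass_eq (f g : Lfun_t) : f = g %[ae mu] -> Lclass f = Lclass g.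
Proof.
move=> fg; apply: Lspace_eqP.
apply: ae_eq_trans (Lrepr_class f) _.
apply: ae_eq_trans fg _; exact/ae_eq_sym/Lrepr_class.
Qed.

HB.instance Definition _ := gen_eqMixin Lp.
HB.instance Definition _ := gen_choiceMixin Lp.

Definition Lspace_add (f g : Lp) : Lp := Lclass (Lrepr f + Lrepr g).
Definition Lspace_opp (f : Lp) : Lp := Lclass (- Lrepr f).
Definition Lspace_scale (a : R) (f : Lp) : Lp := Lclass (a *: Lrepr f).

Lemma Lclass_addE (f g : Lfun_t) :
  Lspace_add (Lclass f) (Lclass g) = Lclass (f + g).
Proof.
apply: Lclass_eq.
apply: filterS2 (Lrepr_class f) (Lrepr_class g) => x fx gx xT.
by congr (_ + _); [exact: fx|exact: gx].
Qed.

Lemma Lclass_scaleE a (f : Lfun_t) :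
  Lspace_scale a (Lclass f) = Lclass (a *: f).
Proof.
apply: Lclass_eq; apply: filterS (Lrepr_class f) => x fx xT.
by congr (_ *: _); exact: fx.
Qed.

Lemma Lclass_oppE (f : Lfun_t) : Lspace_opp (Lclass f) = Lclass (- f).
Proof.
apply: Lclass_eq; apply: filterS (Lrepr_class f) => x fx xT.
by congr (- _); exact: fx.
Qed.

Lemma Lspace_addA : associative Lspace_add.
Proof.
move=> f g h; rewrite -[f]Lclass_repr -[g]Lclass_repr -[h]Lclass_repr.
by rewrite !Lclass_addE addrA.
Qed.

Lemma Lspace_addC : commutative Lspace_add.
Proof. by move=> f g; rewrite /Lspace_add addrC. Qed.

Lemma Lspace_add0 : left_id (Lclass 0) Lspace_add.
Proof. by move=> f; rewrite -[f]Lclass_repr Lclass_addE add0r. Qed.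

Lemma Lspace_addN : left_inverse (Lclass 0) Lspace_opp Lspace_add.
Proof. by move=> f; rewrite -[f]Lclass_repr Lclass_oppE Lclass_addE addNr. Qed.

HB.instance Definition _ := GRing.isZmodule.Build Lp
  Lspace_addA Lspace_addC Lspace_add0 Lspace_addN.

Lemma LclassD (f g : Lfun_t) : Lclass (f + g) = Lclass f + Lclass g.
Proof. exact/esym/Lclass_addE. Qed.

Lemma Lspace_scaleA a b (f : Lp) :
  Lspace_scale a (Lspace_scale b f) = Lspace_scale (a * b) f.
Proof. by rewrite -[f]Lclass_repr !Lclass_scaleE scalerA. Qed.

Lemma Lspace_scale1 : left_id 1 Lspace_scale.
Proof. by move=> f; rewrite -[f]Lclass_repr Lclass_scaleE scale1r. Qed.

Lemma Lspace_scaleDr : right_distributive Lspace_scale +%R.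
Proof.
move=> a f g; rewrite -[f]Lclass_repr -[g]Lclass_repr.
by rewrite -LclassD !Lclass_scaleE -LclassD scalerDr.
Qed.

Lemma Lspace_scaleDl f : {morph Lspace_scale^~ f : a b / a + b}.
Proof.
by move=> a b; rewrite -[f]Lclass_repr !Lclass_scaleE -LclassD scalerDl.
Qed.

HB.instance Definition _ := GRing.Zmodule_isLmodule.Build R Lp
  Lspace_scaleA Lspace_scale1 Lspace_scaleDr Lspace_scaleDl.

Lemma LclassZ a (f : Lfun_t) : Lclass (a *: f) = a *: Lclass f.
Proof. exact/esym/Lclass_scaleE. Qed.

Definition Lspace_norm (f : Lp) : R := fine ('N[mu]_p[EFin \o Lrepr f])%E.

Lemma Lspace_norm_class (f : Lfun_t) :
  Lspace_norm (Lclass f) = fine ('N[mu]_p[EFin \o f])%E.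
Proof. by rewrite /Lspace_norm (ae_eq_Lnorm (Lrepr_class f)). Qed.

Lemma Lspace_ler_normD f g :
  Lspace_norm (f + g) <= Lspace_norm f + Lspace_norm g.
Proof.
rewrite -[f]Lclass_repr -[g]Lclass_repr -LclassD !Lspace_norm_class.
exact: ler_LnormD.
Qed.

Lemma Lspace_normrZ a f : Lspace_norm (a *: f) = `|a| * Lspace_norm f.
Proof.
rewrite -[f]Lclass_repr -LclassZ !Lspace_norm_class LnormZ.
by rewrite fineM// -finite_norm_fine.
Qed.

Lemma Lspace_normr0_eq0 f : Lspace_norm f = 0 -> f = 0.
Proof.
rewrite -[f]Lclass_repr Lspace_norm_class => /fine_Lnormr_eq0 f0.
exact: Lclass_eq.
Qed.

HB.instance Definition _ := Lmodule_isNormed.Build R Lp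
  Lspace_ler_normD Lspace_normrZ Lspace_normr0_eq0.

End Lspace_normed_module.

(* Indices start at 0: [cube n] is the space {0,1}^(n+1), so that the family
   [cube 0, cube 1, ...] is {0,1}^1, {0,1}^2, ... *)
Definition cube (n : nat) : Type := {ffun 'I_n.+1 -> bool}.
HB.instance Definition _ n := Finite.on (cube n).
HB.instance Definition _ n := isPointed.Build (cube n) [ffun=> false].
HB.instance Definition _ n := @isMeasurable.Build default_measure_display
  (cube n) discrete_measurable discrete_measurable0
  discrete_measurableC discrete_measurableU.

(* The fallback measure [dirac point] of [mnormalize] is irrelevant, since
   [counting] is finite and nonzero on [cube n]; see [cube_muE]. *)
Definition cube_mu (R : realType) (n : nat) : probability (cube n) R :=
  mnormalize counting (dirac point).

Definition cube_seq : Type := forall n, cube n.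
HB.instance Definition _ := Pointed.on cube_seq.

(* Generators of the product sigma-algebra. *)
Definition coord_events : set (set cube_seq) :=
  \bigcup_n preimage_set_system setT (fun w : cube_seq => w n) measurable.

Definition Omega : Type := g_sigma_algebraType coord_events.
HB.instance Definition _ := Measurable.on Omega.

Definition coord n (w : Omega) : cube n := w n.

Definition is_product_measure (R : realType) (P : probability Omega R) :=
  forall N (A : forall n, set (cube n)),
  (P [set w | forall n, (n < N)%N -> A n (coord n w)]
   = \prod_(n < N) cube_mu R n (A n))%E.

Lemma cube_muE (R : realType) n (A : set (cube n)) :
  cube_mu R n A = ((#|[set x in A]|)%:R / (2 ^ n.+1)%:R)%:E.
Proof.
rewrite /cube_mu /= /mnormalize.
pose c : {measure set (cube n) -> \bar R} := counting.
have cE (B : set (cube n)) : c B = (#|[set x in B]|)%:R%:E.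
  have Bf : finite_set B by exact: finite_finset.
  rewrite /c /= /counting asboolT//; congr (_%:R%:E).
  rewrite cardE; apply: perm_size; apply: uniq_perm.
  - exact: finmap.fset_uniq.
  - exact: enum_uniq.
  - by move=> x; rewrite mem_enum inE; exact: in_fset_set.
rewrite -/c !cE.
have -> : #|[set x in [set: cube n]%classic]%SET| = (2 ^ n.+1)%N.
  transitivity #|{: {ffun 'I_n.+1 -> bool}}|; last first.
    by rewrite card_ffun card_bool card_ord.
  by apply: eq_card => x; rewrite !inE; apply: mem_set.
rewrite ifF; last by rewrite orbF eqe pnatr_eq0 expn_eq0.
by rewrite cE.
Qed.

(* The infinite product measure is not in the library.  It is obtained as the
   image of Lebesgue measure on [0, 1[ under the mixed-radix expansion with
   radices 2^(n+1), whose n-th digit selects a point of [cube n]. *)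
Definition radix (n : nat) : nat := 2 ^ n.+1.
Definition radix_prod (n : nat) : nat := \prod_(k < n) radix k.
Definition cube_of_digit n (i : nat) : cube n :=
  nth (point : cube n) (enum {: cube n} : seq (cube n)) i.
Definition radix_expansion (R : realType) (x : R) : Omega := fun n =>
  cube_of_digit n (Num.truncn (x * (radix_prod n.+1)%:R) %% radix n).

Fixpoint digits_in (A : forall n, set (cube n)) (N t : nat) : bool :=
  if N is N'.+1 then
    (cube_of_digit N' (t %% radix N') \in A N')
    && digits_in A N' (t %/ radix N')
  else true.

Section product_measure_existence.
Variable R : realType.
Local Notation m := radix.
Local Notation M := radix_prod.
Local Notation dec := cube_of_digit.
Local Notation X := (@radix_expansion R).

Lemma truncn_divn (y : R) m : (0 < m)%N -> 0 <= y ->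
  Num.truncn y = (Num.truncn (y * m%:R) %/ m)%N.
Proof.
move=> m0 y0; set t := Num.truncn (y * m%:R).
have ym0 : 0 <= y * m%:R by rewrite mulr_ge0.
have /andP[h1 h2] := truncn_itv ym0; rewrite -/t in h1 h2.
have m0' : 0 < m%:R :> R by rewrite ltr0n.
apply: truncn_def; apply/andP; split.
  rewrite -(ler_pM2r m0') -natrM; apply: le_trans h1.
  by rewrite ler_nat leq_trunc_div.
rewrite -(ltr_pM2r m0') -natrM; apply: lt_le_trans h2 _.
by rewrite ler_nat ltn_ceil.
Qed.

Lemma measurable_truncn_preimage (c : R) (S : set nat) :
  measurable ([set x : R | S (Num.truncn (x * c))]).
Proof.
have H : measurable_fun setT (fun x : R => Num.truncn (x * c)).
  have mgt k : measurable [set x : R | (k < Num.truncn (x * c))%N].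
    rewrite (_ : [set x : R | _] = ( *%R^~ c) @^-1` `[k.+1%:R, +oo[%classic).
      rewrite -[X in measurable X]setTI.
      by apply: measurable_funM.
    by apply/seteqP; split => x /=; rewrite truncn_gt_nat in_itv/= andbT.
  move=> _ B _; rewrite setTI.
  rewrite (_ : _ @^-1` B =
      \bigcup_(k in B) [set x : R | Num.truncn (x * c) = k]); last first.
    apply/seteqP; split => x /=; last by case=> k Bk /= ->.
    by move=> Bx; exists (Num.truncn (x * c)).
  apply: bigcup_measurable => k _.
  case: k => [|k].
    rewrite (_ : [set x | _] = ~` [set x : R | (0 < Num.truncn (x * c))%N]).
      exact: measurableC.
    by apply/seteqP; split => x /=; case: (Num.truncn _).
  rewrite (_ : [set x | _] = [set x : R | (k < Num.truncn (x * c))%N] `\`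
    [set x : R | (k.+1 < Num.truncn (x * c))%N]); first exact: measurableD.
  apply/seteqP; split => x /=; first by move=> ->; split=> //; rewrite ltnn.
  by case=> h1 /negP; rewrite -leqNgt => h2; apply/eqP; rewrite eqn_leq h1 h2.
by have := H measurableT S I; rewrite setTI.
Qed.

Lemma radix_gt0 n : (0 < m n)%N. Proof. by rewrite /radix expn_gt0. Qed.
Local Hint Resolve radix_gt0 : core.

Lemma radix_prod_gt0 n : (0 < M n)%N.
Proof. exact: prodn_gt0. Qed.
Local Hint Resolve radix_prod_gt0 : core.

Lemma radix_prodS n : M n.+1 = (M n * m n)%N.
Proof. by rewrite /radix_prod big_ord_recr. Qed.

Lemma measurable_radix_expansion : measurable_fun setT X.
Proof.
apply: (@measurability _ _ _ (g_sigma_algebraType coord_events)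
  setT X coord_events erefl).
move=> _ [_ [n _ [B _ <-]] <-]; rewrite !setTI /=.
exact: (measurable_truncn_preimage (M n.+1)%:R
  (fun t => B (dec n (t %% m n)%N))).
Qed.

Section cylinders.
Variable A : forall n, set (cube n).
Arguments A : clear implicits.

Local Notation good := (digits_in A).

Lemma digits_inP (x : R) N : 0 <= x ->
  (forall n, (n < N)%N -> A n (X x n)) <-> good N (Num.truncn (x * (M N)%:R)).
Proof.
move=> x0; elim: N => [|N IH] //=.
rewrite radix_prodS natrM mulrA -truncn_divn// ?mulr_ge0//.
rewrite -mulrA -natrM -radix_prodS.
split.
  move=> h; apply/andP; split; first by apply: mem_set; apply: (h N).
  by apply/IH => n nN; apply: h; rewrite ltnW.
case/andP => /set_mem h1 /IH h2 n; rewrite ltnS leq_eqVlt => /predU1P[->//|].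
exact: h2.
Qed.

Lemma count_digit n :
  (\sum_(0 <= r < m n) (dec n r \in A n) = #|[set x in A n]%SET|)%N.
Proof.
have sz : size (enum {: cube n}) = m n.
  rewrite -cardE; transitivity #|{: {ffun 'I_n.+1 -> bool}}| => //.
  by rewrite card_ffun card_bool card_ord.
rewrite -sz -(big_nth (point : cube n) xpredT
  (fun x => nat_of_bool (x \in A n))).
rewrite big_enum /= -big_mkcond /= sum1_card.
by apply: eq_card => x; rewrite inE.
Qed.

Lemma count_digits_in N :
  (\sum_(0 <= t < M N) good N t = \prod_(n < N) #|[set x in A n]%SET|)%N.
Proof.
elim: N => [|N IH]; first by rewrite /radix_prod !big_ord0 big_nat1.
rewrite radix_prodS big_nat_mul big_ord_recr /= -IH big_distrl /=.
apply: eq_bigr => i _.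
rewrite -count_digit [RHS]mulnC big_distrl /=.
rewrite -{1}[(i * m N)%N]add0n big_addn mulSn addnK.
apply: eq_big_nat => r /andP[_ rm].
by rewrite addnC modnMDl divnMDl // modn_small // divn_small // addn0 mulnb.
Qed.

Lemma measurable_itv01 : measurable (`[0, 1[%classic : set R).
Proof. by []. Qed.

Lemma lebesgue_radix_expansion N :
  mrestr lebesgue_measure measurable_itv01
    (X @^-1` [set w | forall n, (n < N)%N -> A n (coord n w)])
  = (\prod_(n < N) cube_mu R n (A n))%E.
Proof.
pose F (t : nat) : set R := if good N t
  then `[t%:R / (M N)%:R, t.+1%:R / (M N)%:R[%classic else set0.
have M0 : 0 < (M N)%:R :> R by rewrite ltr0n.
have FE t x : F t x <-> [/\ good N t, 0 <= x & Num.truncn (x * (M N)%:R) = t].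
  rewrite /F; case: ifPn => [gt|/negP ngt]; last first.
    by split=> [[]|[gt _ _]]; exact: ngt.
  rewrite /= in_itv/= ler_pdivrMr// ltr_pdivlMr//; split.
    move=> xt; split => //; last exact: truncn_def.
    by rewrite -(pmulr_lge0 _ M0); case/andP: xt => /(le_trans (ler0n _ _)).
  case=> _ x0 <-; apply: truncn_itv; exact: mulr_ge0.
rewrite /mrestr.
have -> : X @^-1` [set w | forall n, (n < N)%N -> A n (coord n w)] `&`
    `[0, 1[%classic = \big[setU/set0]_(t < M N) F t.
  rewrite -bigcup_mkord; apply/seteqP; split => x.
    move=> [/= h]; rewrite in_itv/= => /andP[x0 x1].
    exists (Num.truncn (x * (M N)%:R)) => /=.
      by rewrite truncn_lt_nat ?mulr_ge0// gtr_pMl.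
    by apply/FE; split => //; apply/digits_inP.
  case=> t /= tM /FE[gt x0 xt]; split => /=.
    by apply/digits_inP => //; rewrite xt.
  rewrite in_itv/= x0 -(ltr_pM2r M0) mul1r.
  by rewrite -truncn_lt_nat ?mulr_ge0// xt.
rewrite measure_bigsetU; last 2 first.
- by move=> t; rewrite /F; case: ifPn.
- apply/trivIsetP => i j _ _ ij; apply/seteqP; split => // x.
  by move=> [/FE[_ _ xi] /FE[_ _ xj]]; rewrite -xi -xj eqxx in ij.
transitivity (\sum_(t < M N) ((good N t)%:R / (M N)%:R : R)%:E)%E.
  apply: eq_bigr => t _; rewrite /F.
  case: ifPn => _; last by rewrite measure0 mul0r.
  rewrite /= lebesgue_measure_itv/= lte_fin ltr_pM2r ?invr_gt0// ltr_nat ltnSn.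
  by rewrite -EFinB -mulrBl -natr1 addrAC subrr add0r.
rewrite sumEFin -mulr_suml -natr_sum.
rewrite -(big_mkord xpredT (fun t => nat_of_bool (good N t))) count_digits_in.
rewrite /radix_prod !natr_prod -prodf_div -prodEFin.
by apply: eq_bigr => n _; rewrite cube_muE.
Qed.

End cylinders.

Theorem product_measure_exists :
  exists P : probability Omega R, is_product_measure P.
Proof.
pose leb01 := mrestr (@lebesgue_measure R) measurable_itv01.
have leb01T : leb01 setT = 1%E.
  rewrite /leb01 /mrestr setTI lebesgue_measure_itv/= lte_fin ltr01.
  by rewrite -EFinB subr0.
pose P0 : probability (measurableTypeR R) R :=
  HB.pack leb01 (Measure_isProbability.Build _ _ _ leb01 leb01T).
pose X' : {mfun measurableTypeR R >-> Omega} :=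
    HB.pack (X : measurableTypeR R -> Omega)
    (isMeasurableFun.Build _ _ (measurableTypeR R) Omega _
      measurable_radix_expansion).
exists (distribution P0 X') => N A; exact: lebesgue_radix_expansion.
Qed.

End product_measure_existence.

Definition Omega_mu (R : realType) : probability Omega R :=
  sval (cid (product_measure_exists R)).

Lemma Omega_muP (R : realType) : is_product_measure (Omega_mu R).
Proof. exact: svalP (cid (product_measure_exists R)). Qed.

Definition lin_span (R : pzRingType) (V : lmodType R) (A : set V) : set V :=
  [set x | exists n (a : 'I_n -> R) (v : 'I_n -> V),
    (forall i, A (v i)) /\ x = \sum_(i < n) a i *: v i].

(* [U] is only meaningful on the subspace [E]. *)
Definition surjective_linear_isometry (R : realType) (V : normedModType R)
    (E : set V) (U : V -> V) : Prop :=
  [/\ forall (a : R) x y, E x -> E y -> U (a *: x + y) = a *: U x + U y,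
      forall x, E x -> `|U x| = `|x|
    & U @` E = E].

Lemma lt1_le1e (R : realType) (p : R) : 1 < p -> (1 <= p%:E)%E.
Proof. by move=> p_gt1; rewrite lee_fin ltW. Qed.

Section Bourgain_Rosenthal_Schechtman.
Variables (R : realType) (p : R) (p_gt1 : 1 < p).

Definition LpOmega : normedModType R :=
  LspaceType (Omega_mu R) (lt1_le1e p_gt1).

Lemma comp_proj_Lfun n (f : cube n -> R) :
  f \o coord n \in Lfun (Omega_mu R) p%:E.
Proof.
have mproj : measurable_fun setT (@coord n).
  move=> _ B _; apply: sub_sigma_algebra; exists n => //.
  by exists B.
have mf : measurable_fun setT f by move=> _ B _; rewrite setTI.
have mfproj : measurable_fun setT (f \o @coord n) by exact: measurableT_comp.
apply/andP; split; rewrite inE //= /finite_norm.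
pose C : R := \sum_(a : cube n) `|f a|.
have fC a : `|f a| <= C by rewrite /C (bigD1 a)//= lerDl sumr_ge0.
have p0 : 0 <= p by rewrite (le_trans ler01)// ltW.
apply: (@le_lt_trans _ _ ('N[Omega_mu R]_p%:E[EFin \o cst C])%E); last first.
  have /andP[_] := Lfun_cst (Omega_mu R) C p.
  by rewrite inE.
rewrite unlock gt0_ler_poweR ?invr_ge0// ?in_itv/= ?leey ?integral_ge0//.
apply: ge0_le_integral => //=.
  apply/measurable_EFinP.
  apply/(@measurableT_comp _ _ _ _ _ _ (fun y : R => y `^ p)%R) => //.
  exact: measurableT_comp mfproj.
move=> w _; rewrite lee_fin ge0_ler_powR ?nnegrE//.
by rewrite (le_trans (fC _))// ler_norm.
Qed.

(* Points of [cube n] have positive measure, so that L^p([cube n]) consists of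
   functions rather than classes; every function on [cube n] is in it. *)
Definition Hn n : set (cube n -> R) :=
  [set f | f \in Lfun (cube_mu R n) p%:E /\
           (\int[cube_mu R n]_x (f x)%:E = 0)%E].

Definition Jn n (f : cube n -> R) : LpOmega :=
  Lclass (Lfun_Sub (lt1_le1e p_gt1) (comp_proj_Lfun f)).

Definition one_Omega : LpOmega :=
  Lclass (Lfun_Sub (lt1_le1e p_gt1) (Lfun_cst (Omega_mu R) 1 p)).

Definition X_omega : set LpOmega :=
  closure (lin_span (\bigcup_n (@Jn n @` @Hn n))).

Definition R_omega : set LpOmega :=
  [set c *: one_Omega + x | c in [set: R] & x in X_omega].

Definition exterior_decomposition (x : LpOmega) (f : forall n, cube n -> R) :
    Prop :=
  [/\ X_omega x, forall n, Hn (f n)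
    & series (fun n => Jn (f n)) @ \oo --> x].

End Bourgain_Rosenthal_Schechtman.

(* Main.v *)
Require Import Defs.
From HB Require Import structures.
From mathcomp Require Import all_boot all_order all_algebra.
From mathcomp Require Import perm.
From mathcomp Require Import all_classical all_reals all_analysis.
From mathcomp Require Import measurable_realfun.
From mathcomp Require Import ring lra.
Set Implicit Arguments.
Unset Strict Implicit.
Unset Printing Implicit Defensive.
Import Order.TTheory GRing.Theory Num.Theory numFieldNormedType.Exports.
Local Open Scope classical_set_scope.
Local Open Scope ring_scope.

(** Write [x] in R_omega as a constant plus a sum of functions of separate
    coordinates.  Freezing all coordinates but two, [x] becomes an additive
    function [s + u(a) + v(b)] on a finite grid, and such functions have very
    rigid supports; this is what determines the isometries.

    Since [p != 2], an isometry maps functions with disjoint supports to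
    functions with disjoint supports ([LdisjointP], [iso_disjoint]): for two
    functions the defect in the parallelogram law for p-th powers of norms is
    the integral of a function of constant sign, which vanishes exactly where
    one of the two functions does.

    On the side of R_omega, two facts on supports are needed.  Among three
    nonzero elements with pairwise disjoint supports, each depends on one
    coordinate only ([three_disjoint]); two would not be enough, as the sum and
    the difference of two functions with values 1 and -1 of different
    coordinates have disjoint supports.  An element with values 0 and 1 depends
    on one coordinate only ([idempotent_single]).  Moreover, nonzero functions
    of distinct coordinates never have disjoint supports.

    Now the constant 1 is, for every [k > 0], the sum of the indicators of the
    [2^(k+1) > 2] points of the [k]-th cube (numbered from 0).  Their images
    depend on one and the same coordinate [m], and counting points gives
    [k <= m].  So the image of 1 depends only on the coordinate [m], where [m]
    can be taken arbitrarily large: it is a constant, that is 1 or -1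
    ([iso_one]).  Consequently, up to this sign, indicators are mapped to
    indicators, so for every [k] the functions of coordinate [k] are mapped to
    functions of one coordinate [m >= k]; the inverse isometry gives [m <= k]
    ([iso_coordinate]).  The images of the points of the [k]-th cube then have
    disjoint supports in that same cube, hence are single points, and
    [phi k] is the inverse of the permutation obtained ([iso_bijection]).
    Linearity and continuity extend the formula to convergent series.

    The pointwise statements about grids make sense almost everywhere, because
    permuting the values of one coordinate preserves the product measure: an
    almost sure property remains almost surely true after any change of
    finitely many coordinates ([ae_upd]). *)

Local Notation coord := Defs.coord.

(** * Changing one coordinate *)

Definition upd (w : Omega) (i : nat) (a : cube i) : Omega :=
  @eqtype.dfwith _ cube w i a.

Definition act i (s : {perm cube i}) (w : Omega) : Omega :=
  upd w (s (coord i w)).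

Lemma upd_same w i (a : cube i) : coord i (upd w a) = a.
Proof. exact: dfwith_in. Qed.

Lemma upd_other w i (a : cube i) j : i != j -> coord j (upd w a) = coord j w.
Proof. exact: dfwith_out. Qed.

Lemma upd_upd w i (a b : cube i) : upd (upd w a) b = upd w b.
Proof.
apply: functional_extensionality_dep => j; rewrite /upd.
by case: (eqVneq i j) => [<-|ij]; rewrite ?eqtype.dfwith_in ?eqtype.dfwith_out.
Qed.

Lemma upd_id w i : upd w (coord i w) = w.
Proof.
apply: functional_extensionality_dep => j; rewrite /upd.
by case: (eqVneq i j) => [<-|ij]; rewrite ?eqtype.dfwith_in ?eqtype.dfwith_out.
Qed.

(** A change of coordinate is not measure preserving, but it agrees at each
    point with one of finitely many measure-preserving maps. *)
Lemma upd_act w i (a : cube i) : upd w a = act (tperm (coord i w) a) w.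
Proof. by rewrite /act tpermL. Qed.

Definition cylinders : set (set Omega) :=
  [set B | exists N (A : forall n, set (cube n)),
    B = [set w | forall n, (n < N)%N -> A n (coord n w)]].

Lemma measurable_coord n : measurable_fun setT (@coord n).
Proof. by move=> _ B _; apply: sub_sigma_algebra; exists n => //; exists B. Qed.

Lemma measurable_act i (s : {perm cube i}) : measurable_fun setT (act s).
Proof.
apply: (@measurability _ _ _ (g_sigma_algebraType coord_events)
  setT (act s) coord_events erefl).
move=> _ [_ [n _ [B _ <-]] <-]; rewrite !setTI /=.
have mB (C : set (cube n)) : measurable (@coord n @^-1` C).
  by rewrite -[X in measurable X]setTI; exact: measurable_coord.
case: (eqVneq i n) B mB => [<-|ni] B mB.
  rewrite (_ : _ @^-1` _ = coord i @^-1` (s @^-1` B)); first exact: mB.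
  by apply/funext => w /=; rewrite -/(coord i (act s w)) upd_same.
rewrite (_ : _ @^-1` _ = @coord n @^-1` B); first exact: mB.
by apply/funext => w /=; rewrite -/(coord n (act s w)) upd_other.
Qed.

Lemma cylinders_measurable : cylinders `<=` measurable.
Proof.
move=> _ [N [A ->]].
rewrite (_ : [set w | _] = \bigcap_(n in `I_N) (@coord n @^-1` A n));
  last first.
  by apply/seteqP; split => w /= h n; apply: h.
apply: bigcap_measurableType => n _.
by rewrite -[X in measurable X]setTI; exact: measurable_coord.
Qed.

Lemma cylinders_generate (B : set Omega) : measurable B -> <<s cylinders >> B.
Proof.
apply: smallest_sub; first exact: smallest_sigma_algebra.
move=> _ [n _ [B' _ <-]]; apply: sub_sigma_algebra.
(* The set [B'] constrains coordinate [n] only. *)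
exists n.+1, (fun k => if eqP is ReflectT e then
   eq_rect n (fun k => set (cube k)) B' k e else setT).
rewrite setTI; apply/seteqP; split => w /=.
  move=> wB k _; case: eqP => // e; by case: _ / e.
by move=> /(_ n (ltnSn n)); case: eqP => // e; rewrite eq_axiomK.
Qed.

Section product_measure.
Variable R : realType.
Local Notation mu := (Omega_mu R).

Lemma cube_mu_perm n (s : {perm cube n}) (A : set (cube n)) :
  cube_mu R n (s @^-1` A) = cube_mu R n A.
Proof.
rewrite !cube_muE; congr (_%:R / _)%:E.
rewrite -[RHS](card_preimset _ (@perm_inj _ s)).
apply: eq_card => x; rewrite !inE.
by apply/idP/idP => /set_mem h; exact/mem_set.
Qed.

(** The permutation maps cylinders to cylinders of the same measure, and a
    finite measure is determined by its values on cylinders. *)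
Lemma act_preserves i (s : {perm cube i}) (B : set Omega) :
  measurable B -> mu (act s @^-1` B) = mu B.
Proof.
move=> /cylinders_generate.
pose actm : {mfun Omega >-> Omega} :=
  HB.pack (act s) (isMeasurableFun.Build _ _ _ _ _ (measurable_act s)).
pose nu := distribution mu actm.
apply: (g_sigma_algebra_measure_unique _ cylinders_measurable (fun=> setT)
  _ _ nu mu).
- by move=> _; exists 0, (fun=> setT); apply/seteqP; split.
- by apply/seteqP; split => // w _; exists 0.
- move=> _ _ [N [A ->]] [N' [A' ->]].
  exists (maxn N N'), (fun n => (if (n < N)%N then A n else setT) `&`
     (if (n < N')%N then A' n else setT)).
  apply/seteqP; split => w /=.
    move=> [h h'] n _; split; case: ifPn => // nN; [exact: h|exact: h'].
  move=> h; split => n nN; have := h n;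
    by rewrite leq_max nN ?orbT => /(_ isT)[].
- (* The preimage of a cylinder replaces [A i] by its preimage under [s]. *)
  move=> _ [N [A ->]]; set C : set Omega := [set w | _].
  change (mu (act s @^-1` C) = mu C); rewrite {}/C.
  pose A' := @eqtype.dfwith _ (fun n => set (cube n)) A i (s @^-1` A i).
  transitivity (mu [set w | forall n, (n < N)%N -> A' n (coord n w)]).
    congr (mu _); apply/funext => w /=; apply/propext.
    split=> h n /h; rewrite /A'; case: (eqVneq i n) => [<-|ni].
    + by rewrite dfwith_in upd_same.
    + by rewrite dfwith_out// upd_other.
    + by rewrite dfwith_in upd_same.
    + by rewrite dfwith_out// upd_other.
  rewrite !Omega_muP; apply: eq_bigr => n _.
  rewrite /A'; case: (eqVneq i n) => [<-|ni].
    by rewrite dfwith_in cube_mu_perm.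
  by rewrite dfwith_out.
- by move=> k; rewrite [X in (X < _)%E]probability_setT ltry.
Qed.

Lemma ae_act (P : set Omega) i (s : {perm cube i}) :
  (\forall w \ae mu, P w) -> \forall w \ae mu, P (act s w).
Proof.
move=> [N [mN N0 PN]]; exists (act s @^-1` N); split.
- by rewrite -[X in measurable X]setTI; exact: measurable_act.
- by rewrite act_preserves.
- by move=> w /= /PN.
Qed.

Lemma ae_forall_fin (I : finType) (P : I -> set Omega) :
  (forall i, \forall w \ae mu, P i w) -> \forall w \ae mu, forall i, P i w.
Proof.
move=> h; exact: filter_forall.
Qed.

Lemma ae_and (P Q : set Omega) : (\forall w \ae mu, P w) ->
  (\forall w \ae mu, Q w) -> \forall w \ae mu, P w /\ Q w.
Proof. exact: filterI. Qed.

(** Finitely many permutations of a cube suffice to change one coordinate in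
    all possible ways. *)
Lemma ae_upd (P : set Omega) i :
  (\forall w \ae mu, P w) -> \forall w \ae mu, forall a : cube i, P (upd w a).
Proof.
move=> aeP.
have /ae_forall_fin : forall s : {perm cube i}, \forall w \ae mu, P (act s w).
  by move=> s; exact: ae_act.
by apply: filterS => w h a; rewrite upd_act.
Qed.

Lemma ae_ex (P : set Omega) : (\forall w \ae mu, P w) -> exists w, P w.
Proof.
move=> aeP; apply: (@filter_ex _ (almost_everywhere mu)) => //.
apply: ae_properfilter_algebraOfSetsType.
by rewrite [ltRHS](probability_setT mu) lte01.
Qed.

End product_measure.

(** * Disjointness of supports from norms *)

Section scalar.
Variable R : realType.
Implicit Types a b s t p q : R.

Lemma powR_midpoint q s t : 1 <= q -> 0 <= s -> 0 <= t ->
  2 * ((s + t) / 2) `^ q <= s `^ q + t `^ q.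
Proof.
move=> q1 s0 t0; have h0 : 0 <= 2^-1 :> R by lra.
have h1 : 2^-1 <= 1 :> R by lra.
have := convex_powR q1 (Itv01 h0 h1) (x := s) (y := t).
rewrite !inE /= !in_itv /= !andbT => /(_ s0 t0).
rewrite convRE [X in X `^ _ <= _]convRE /= /unstable.onem.
rewrite (_ : 1 - 2^-1 = 2^-1 :> R); last by lra.
by rewrite -!mulrDr [(s + t) / 2]mulrC => mid; lra.
Qed.

Lemma powR_superadditive q s t : 1 < q -> 0 < s -> 0 < t ->
  s `^ q + t `^ q < (s + t) `^ q.
Proof.
move=> q1 s0 t0; have q0 : 0 < q by lra.
have q10 : 0 < q - 1 by lra.
rewrite -!(@mulr_powRB1 _ _ q)//; try lra.
rewrite mulrDl ltrD// ltr_pM2l// gt0_ltr_powR// ?nnegrE; lra.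
Qed.

Lemma powR_half_sqr p a : (a ^+ 2) `^ (p / 2) = `|a| `^ p.
Proof.
rewrite -real_normK ?num_real// -powR_mulrn// -powRrM.
by congr (_ `^ _); field.
Qed.

Definition parallelogram_defect p a b :=
  `|a + b| `^ p + `|a - b| `^ p - 2 * (`|a| `^ p + `|b| `^ p).

Lemma defect_disjoint p a b : 0 < p -> a * b = 0 ->
  parallelogram_defect p a b = 0.
Proof.
rewrite /parallelogram_defect => p0 /eqP; rewrite mulf_eq0 => /orP[]/eqP ->.
  by rewrite add0r sub0r normrN normr0 powR0 ?gt_eqF//; ring.
by rewrite addr0 subr0 normr0 powR0 ?gt_eqF//; ring.
Qed.

(** With [q = p / 2 > 1], convexity of [q]-th powers at [(a + b)^2] and
    [(a - b)^2], whose mean is [a^2 + b^2], reduces the claim to the strict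
    superadditivity of [q]-th powers. *)
Lemma defect_gt0 p a b : 2 < p -> a * b != 0 -> 0 < parallelogram_defect p a b.
Proof.
move=> p2; rewrite mulf_eq0 negb_or => /andP[a0 b0].
rewrite /parallelogram_defect -!powR_half_sqr.
have q1 : 1 < p / 2 by lra.
have := powR_midpoint (ltW q1) (sqr_ge0 (a + b)) (sqr_ge0 (a - b)).
rewrite (_ : _ / 2 = a ^+ 2 + b ^+ 2); last by field.
have : 0 < a ^+ 2 by rewrite exprn_even_gt0.
have : 0 < b ^+ 2 by rewrite exprn_even_gt0.
move=> B A; have := powR_superadditive q1 A B; lra.
Qed.

(** Here [p / 2 < 1]: both inequalities used for [2 < p] are applied to the
    inverse power [2 / p > 1] and turn around. *)
Lemma defect_lt0 p a b : 0 < p -> p < 2 -> a * b != 0 ->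
  parallelogram_defect p a b < 0.
Proof.
move=> p0 p2; rewrite mulf_eq0 negb_or => /andP[a0 b0].
rewrite /parallelogram_defect -!powR_half_sqr.
set q := p / 2; have q0 : 0 < q by rewrite /q; lra.
have r1 : 1 < q^-1 by rewrite invf_gt1// /q; lra.
have qK s : 0 <= s -> (s `^ q) `^ q^-1 = s.
  by move=> s0; rewrite -powRrM mulfV ?gt_eqF// powRr1.
have Kq s : 0 <= s -> (s `^ q^-1) `^ q = s.
  by move=> s0; rewrite -powRrM mulVf ?gt_eqF// powRr1.
have mid : ((a + b) ^+ 2) `^ q + ((a - b) ^+ 2) `^ q <=
    2 * (a ^+ 2 + b ^+ 2) `^ q.
  rewrite mulrC -ler_pdivrMr//.
  set S := (_ + _) / 2.
  have S0 : 0 <= S by rewrite divr_ge0 ?addr_ge0 ?powR_ge0.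
  rewrite -[leLHS]Kq//.
  apply: ge0_ler_powR; rewrite ?nnegrE ?powR_ge0 ?(ltW q0)//.
    by rewrite addr_ge0 ?sqr_ge0.
  have := powR_midpoint (ltW r1) (powR_ge0 ((a + b) ^+ 2) q)
    (powR_ge0 ((a - b) ^+ 2) q).
  rewrite !qK ?sqr_ge0// -/S; lra.
have A : 0 < a ^+ 2 by rewrite exprn_even_gt0.
have B : 0 < b ^+ 2 by rewrite exprn_even_gt0.
have sup : (a ^+ 2 + b ^+ 2) `^ q < (a ^+ 2) `^ q + (b ^+ 2) `^ q.
  have := powR_superadditive r1 (powR_gt0 q A) (powR_gt0 q B).
  rewrite !qK ?sqr_ge0// => sup.
  have AB : 0 <= a ^+ 2 + b ^+ 2 by rewrite addr_ge0 ?ltW.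
  have S0 : 0 <= (a ^+ 2) `^ q + (b ^+ 2) `^ q by rewrite addr_ge0 ?powR_ge0.
  rewrite -[ltRHS]Kq//; apply: gt0_ltr_powR; rewrite ?nnegrE ?powR_ge0//.
lra.
Qed.

Lemma defect_ge0 p a b : 2 < p -> 0 <= parallelogram_defect p a b.
Proof.
move=> p2; have [ab|ab] := eqVneq (a * b) 0; last exact/ltW/defect_gt0.
by rewrite defect_disjoint//; lra.
Qed.

Lemma defect_le0 p a b : 0 < p -> p < 2 -> parallelogram_defect p a b <= 0.
Proof.
move=> p0 p2; have [ab|ab] := eqVneq (a * b) 0; last exact/ltW/defect_lt0.
by rewrite defect_disjoint.
Qed.

End scalar.

Section Lspace.
Context d (T : measurableType d) (R : realType) (p : R).
Variables (mu : {measure set T -> \bar R}) (p1 : (1 <= p%:E)%E).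
Local Notation Lp := (LspaceType mu p1).
Implicit Types x y : Lp.

Lemma Lspace_ext x y : (\forall w \ae mu, Lrepr x w = Lrepr y w) -> x = y.
Proof. by move=> xy; apply: Lspace_eqP; apply: filterS xy => w ->. Qed.

Lemma Lrepr_ae (f : LfunType mu p1) :
  \forall w \ae mu, Lrepr (Lclass f) w = f w.
Proof. by apply: filterS (Lrepr_class f) => w; apply. Qed.

Lemma Lrepr_lin (a : R) x y :
  \forall w \ae mu, Lrepr (a *: x + y) w = a * Lrepr x w + Lrepr y w.
Proof.
have -> : a *: x + y = Lclass (a *: Lrepr x + Lrepr y).
  by rewrite LclassD LclassZ !Lclass_repr.
exact: Lrepr_ae.
Qed.

Lemma Lrepr0 : \forall w \ae mu, Lrepr (0 : Lp) w = 0.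
Proof. exact: (Lrepr_ae 0). Qed.

Lemma Lspace_eq0 x : (\forall w \ae mu, Lrepr x w = 0) -> x = 0.
Proof.
move=> x0; apply: Lspace_ext.
by apply: filterS2 x0 Lrepr0 => w -> ->.
Qed.

Lemma Lspace_normE x :
  (`|x| `^ p)%:E = (\int[mu]_w (`|Lrepr x w| `^ p)%:E)%E.
Proof.
have p0 : p != 0 by rewrite gt_eqF// (lt_le_trans ltr01).
rewrite -poweR_EFin [X in (X `^ _)%E](finite_norm_fine (Lrepr x)).
by rewrite poweR_Lnorm.
Qed.

Lemma powR_norm_integrable x :
  mu.-integrable setT (fun w => (`|Lrepr x w| `^ p)%:E).
Proof.
apply/integrableP; split.
  apply/measurable_EFinP/(measurableT_comp (measurable_powR p)).
  exact: measurableT_comp.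
under eq_integral do rewrite gee0_abs ?lee_fin ?powR_ge0//.
by rewrite -Lspace_normE ltry.
Qed.

Lemma Lspace_normRE x : `|x| `^ p = \int[mu]_w (`|Lrepr x w| `^ p).
Proof. by rewrite /Rintegral -Lspace_normE. Qed.

Lemma measurable_defect x y :
  measurable_fun setT (fun w => parallelogram_defect p (Lrepr x w) (Lrepr y w)).
Proof.
have mpow (f : T -> R) : measurable_fun setT f ->
    measurable_fun setT (fun w => `|f w| `^ p).
  move=> mf; apply/(measurableT_comp (measurable_powR p)).
  exact: measurableT_comp.
have mx z : measurable_fun setT (Lrepr z) by [].
apply: measurable_funB.
  apply: measurable_funD; apply: mpow.
    exact: measurable_funD.
  exact: measurable_funB.
apply: measurable_funM => //; apply: measurable_funD; exact: mpow.
Qed.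

Lemma norm_defect x y : (`|x + y| `^ p + `|x - y| `^ p
    - 2 * (`|x| `^ p + `|y| `^ p))%:E =
  (\int[mu]_w (parallelogram_defect p (Lrepr x w) (Lrepr y w))%:E)%E.
Proof.
have I := powR_norm_integrable.
have I1 : mu.-integrable setT
    (EFin \o (fun w => `|Lrepr (x + y) w| `^ p + `|Lrepr (x - y) w| `^ p)).
  exact: (integrableD _ (I (x + y)) (I (x - y))).
have I2 : mu.-integrable setT
    (EFin \o (fun w => `|Lrepr x w| `^ p + `|Lrepr y w| `^ p)).
  exact: (integrableD _ (I x) (I y)).
have I3 : mu.-integrable setT
    (EFin \o (fun w => 2 * (`|Lrepr x w| `^ p + `|Lrepr y w| `^ p))).
  exact: (integrableZl _ _ I2).
have -> : `|x + y| `^ p + `|x - y| `^ p - 2 * (`|x| `^ p + `|y| `^ p) =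
    \int[mu]_w (`|Lrepr (x + y) w| `^ p + `|Lrepr (x - y) w| `^ p
              - 2 * (`|Lrepr x w| `^ p + `|Lrepr y w| `^ p)).
  rewrite RintegralB// RintegralZl// !RintegralD ?Lspace_normRE//; exact: I.
rewrite /Rintegral fineK; last exact/integrable_fin_num/(integrableB _ I1 I3).
apply: ae_eq_integral => //.
- exact: (measurable_int _ (integrableB _ I1 I3)).
- exact/measurable_EFinP/measurable_defect.
have e1 := Lrepr_lin 1 x y; have e2 := Lrepr_lin (-1) y x.
rewrite scale1r in e1; rewrite scaleN1r addrC in e2.
apply: filterS2 e1 e2 => w e1 e2 _.
by rewrite e1 e2 /parallelogram_defect mul1r mulN1r [- _ + _]addrC.
Qed.

Definition Ldisjoint x y := \forall w \ae mu, Lrepr x w * Lrepr y w = 0.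

(** The pointwise defect has a constant sign, so its integral is zero only if it
    vanishes almost everywhere, that is where one of the functions does. *)
Lemma LdisjointP x y : p != 2 -> Ldisjoint x y <->
  `|x + y| `^ p + `|x - y| `^ p = 2 * (`|x| `^ p + `|y| `^ p).
Proof.
move=> p2; have p0 : 0 < p by rewrite (lt_le_trans ltr01).
split=> [xy|xyE].
  apply/eqP; rewrite -subr_eq0 -eqe norm_defect.
  rewrite (ae_eq_integral (cst 0%:E))//=.
  - by rewrite integral0.
  - exact/measurable_EFinP/measurable_defect.
  - by apply: filterS xy => w xy _; rewrite defect_disjoint.
have int0 := norm_defect x y; rewrite xyE subrr in int0.
have mD := measurable_defect x y.
have Iabs : (\int[mu]_w `|(parallelogram_defect p (Lrepr x w) (Lrepr y w))%:E|
    = 0)%E.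
  move: p2; rewrite neq_lt => /orP[p2|p2].
    have D0 w : parallelogram_defect p (Lrepr x w) (Lrepr y w) <= 0.
      exact: defect_le0.
    rewrite -[LHS]oppeK -integral_ge0N// -[RHS]oppe0; congr (- _)%E.
    rewrite [RHS]int0; apply: eq_integral => w _.
    by rewrite lee0_abs ?oppeK// lee_fin.
  rewrite [RHS]int0; apply: eq_integral => w _; rewrite gee0_abs// lee_fin.
  exact: defect_ge0.
move/ae_eq_integral_abs : Iabs => /(_ measurableT).
move=> /(_ (proj2 (measurable_EFinP _ _) mD)).
apply: filterS => w /(_ I)[D0]; apply/eqP; apply/negPn/negP => xy.
move: p2; rewrite neq_lt => /orP[p2|p2].
  by have := defect_lt0 p0 p2 xy; rewrite D0 ltxx.
by have := defect_gt0 p2 xy; rewrite D0 ltxx.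
Qed.

End Lspace.

(** * Finite-dimensional subspaces are closed *)

Section normed.
Context (R : realType) (V : normedModType R).
Implicit Types (A W : set V) (x y v : V).

Lemma closure_normP A x :
  closure A x <-> forall e : R, 0 < e -> exists2 y, A y & `|x - y| < e.
Proof.
split=> [clA e e0|h B /nbhs_ballP[e /= e0 eB]].
  have [y [Ay]] := clA _ (nbhsx_ballx x e e0).
  by rewrite -ball_normE /= => xy; exists y.
have [y Ay xy] := h e e0; exists y; split => //.
by apply: eB; rewrite -ball_normE.
Qed.

Definition add_line v W : set V := [set c *: v + w | c in [set: R] & w in W].

Definition lin_subspace W :=
  W 0 /\ forall (a : R) x y, W x -> W y -> W (a *: x + y).

Lemma subspaceZ W a x : lin_subspace W -> W x -> W (a *: x).
Proof. by move=> [W0 WL] Wx; rewrite -[_ *: _]addr0; exact: WL. Qed.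

Lemma subspaceD W x y : lin_subspace W -> W x -> W y -> W (x + y).
Proof. by move=> [W0 WL] Wx Wy; rewrite -[x]scale1r; exact: WL. Qed.

Lemma subspaceB W x y : lin_subspace W -> W x -> W y -> W (x - y).
Proof.
by move=> [W0 WL] Wx Wy; rewrite addrC -scaleN1r; exact: WL.
Qed.

Lemma subspace_sum W (I : Type) (r : seq I) (F : I -> V) :
  lin_subspace W -> (forall i, W (F i)) -> W (\sum_(i <- r) F i).
Proof.
move=> subW WF; elim/big_ind : _ => // [|x y]; first exact: subW.1.
exact: subspaceD.
Qed.

Lemma subspace_closure W : lin_subspace W -> lin_subspace (closure W).
Proof.
move=> subW; split; first by apply: subset_closure; exact: subW.1.
move=> a x y /closure_normP clx /closure_normP cly.
apply/closure_normP => e e0.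
have e2 : 0 < e / 2 by rewrite divr_gt0.
have d0 : 0 < e / 2 / (`|a| + 1) by rewrite !divr_gt0// ltr_wpDl.
have [x' Wx' xx'] := clx _ d0; have [y' Wy' yy'] := cly _ e2.
exists (a *: x' + y'); first exact: subW.2.
rewrite opprD addrACA -scalerBr (le_lt_trans (ler_normD _ _))// normrZ.
rewrite [ltRHS]splitr ler_ltD//.
rewrite (le_trans (ler_wpM2l (normr_ge0 a) (ltW xx')))//.
by rewrite mulrCA ger_pMr ?divr_gt0// ler_pdivrMr ?ltr_wpDl// mul1r lerDl.
Qed.

Lemma subspace_add_line v W : lin_subspace W -> lin_subspace (add_line v W).
Proof.
move=> subW; split.
  by exists 0 => //; exists 0; [exact: subW.1|rewrite scale0r addr0].
move=> a _ _ [c _ [w Ww <-]] [c' _ [w' Ww' <-]].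
exists (a * c + c') => //; exists (a *: w + w'); first exact: subW.2.
by rewrite scalerDr scalerDl scalerA addrACA.
Qed.

(** Off [W] the coefficient of [v] is controlled by the norm of the vector,
    because [v] is at positive distance from [W]; the coefficients of
    approximations of a given vector thus converge. *)
Lemma closure_add_line v W : lin_subspace W -> closure W `<=` W ->
  closure (add_line v W) `<=` add_line v W.
Proof.
move=> subW clW x /closure_normP clx.
have [Wv|nWv] := pselect (W v).
  exists 0 => //; exists x; last by rewrite scale0r add0r.
  apply: clW; apply/closure_normP => e /clx[y [c _ [w Ww <-]] xy].
  by exists (c *: v + w) => //; apply: subW.2.
have [d d0 dist] : exists2 d : R, 0 < d & forall w, W w -> d <= `|v - w|.
  apply: contrapT => nd; apply: nWv; apply: clW; apply/closure_normP => e e0.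
  apply: contrapT => ne; apply: nd; exists e => // w Ww.
  by rewrite leNgt; apply/negP => vw; apply: ne; exists w.
have coef c w : W w -> `|c| * d <= `|c *: v + w|.
  move=> Ww; have [->|c0] := eqVneq c 0; first by rewrite normr0 mul0r.
  have -> : c *: v + w = c *: (v - (- c^-1 *: w)).
    by rewrite scaleNr opprK scalerDr scalerA divff// scale1r.
  by rewrite normrZ ler_wpM2l// dist//; apply: subspaceZ.
have inv0 n : 0 < n.+1%:R^-1 :> R by [].
have approx n : {cw : R * V | W cw.2 /\ `|x - (cw.1 *: v + cw.2)| < n.+1%:R^-1}.
  apply: cid; have [_ [c _ [w Ww <-]] xy] := clx _ (inv0 n).
  by exists (c, w).
pose c n := (sval (approx n)).1; pose w n := (sval (approx n)).2.
have Ww n : W (w n) by have [] := svalP (approx n).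
have xcw n : `|x - (c n *: v + w n)| < n.+1%:R^-1.
  by have [] := svalP (approx n).
have cvg_c : cvgn c.
  apply: cauchy_cvg; apply: cauchy_exP => e e0.
  have ed0 : 0 < e * d / 2 by rewrite divr_gt0 ?mulr_gt0.
  have small : \forall n \near \oo, n.+1%:R^-1 < e * d / 2 :> R.
    exact: (near_infty_natSinv_lt (PosNum ed0)).
  have [N _ Nsmall] := small.
  exists (c N); exists N => // n /= Nn; rewrite -ball_normE /= -(ltr_pM2r d0).
  apply: le_lt_trans (coef (c N - c n) (w N - w n) _) _.
    exact: subspaceB.
  have -> : (c N - c n) *: v + (w N - w n) =
      (x - (c n *: v + w n)) - (x - (c N *: v + w N)).
    by rewrite opprB [RHS]addrC [RHS]addrA subrK scalerBl opprD addrACA.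
  rewrite (le_lt_trans (ler_normB _ _))// [ltRHS]splitr ltrD//.
    exact: lt_trans (xcw n) (Nsmall _ _).
  exact: lt_trans (xcw N) (Nsmall _ (leqnn N)).
pose l := limn c.
exists l => //; exists (x - l *: v); last by rewrite addrC subrK.
apply: clW; apply/closure_normP => e e0.
have e2 : 0 < e / 2 by rewrite divr_gt0.
have v1 : 0 < `|v| + 1 by rewrite ltr_wpDl.
have small : \forall n \near \oo, n.+1%:R^-1 < e / 2 :> R.
  exact: (near_infty_natSinv_lt (PosNum e2)).
have near_l : \forall n \near \oo, `|l - c n| < e / 2 / (`|v| + 1).
  by move/cvgrPdist_lt : cvg_c; apply; rewrite divr_gt0.
have [n [n1 n2]] := filter_ex (filterI small near_l).
exists (w n) => //.
have -> : x - l *: v - w n = (x - (c n *: v + w n)) + (c n - l) *: v.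
  rewrite scalerBl opprD !addrA.
  by rewrite (addrAC _ (- w n) (c n *: v)) subrK addrAC.
rewrite (le_lt_trans (ler_normD _ _))// [ltRHS]splitr ltr_leD//.
  exact: lt_trans (xcw n) n1.
rewrite normrZ distrC (le_trans (ler_wpM2r (normr_ge0 v) (ltW n2)))//.
by rewrite mulrAC ler_pdivrMr// ler_wpM2l ?(ltW e2)// lerDl.
Qed.

Fixpoint fspan (s : seq V) : set V :=
  if s is v :: s' then add_line v (fspan s') else [set 0].

Lemma fspan_subspace s : lin_subspace (fspan s).
Proof.
elim: s => [|v s IH] /=; last exact: subspace_add_line.
by split=> // a x y -> ->; rewrite scaler0 addr0.
Qed.

Lemma closure_fspan s : closure (fspan s) `<=` fspan s.
Proof.
elim: s => [|v s IH] /=; last exact: closure_add_line (fspan_subspace s) IH.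
move=> x /closure_normP clx; apply: contrapT => /eqP x0.
have := clx `|x|; rewrite normr_gt0 => /(_ x0)[_ ->].
by rewrite subr0 ltxx.
Qed.

End normed.

(** * Functions of one coordinate *)

Section coordinate_functions.
Variables (R : realType) (p : R) (p_gt1 : 1 < p).
Local Notation mu := (Omega_mu R).
Local Notation p1 := (lt1_le1e p_gt1).
Local Notation Lp := (LspaceType (Omega_mu R) (lt1_le1e p_gt1)).
Local Notation J := (Jn p_gt1).
Local Notation one := (one_Omega p_gt1 : Lp).
Implicit Types x y z : Lp.

Lemma Jn_ae n (f : cube n -> R) :
  \forall w \ae mu, Lrepr (J f : Lp) w = f (coord n w).
Proof. exact: Lrepr_ae. Qed.

Lemma one_ae : \forall w \ae mu, Lrepr one w = 1.
Proof. exact: Lrepr_ae. Qed.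

Lemma Jn_lin n (a : R) (f g : cube n -> R) :
  J (fun b => a * f b + g b) = a *: (J f : Lp) + J g.
Proof.
apply: Lspace_ext.
apply: filterS3 (Lrepr_lin a (J f : Lp) (J g)) (Jn_ae (fun b => a * f b + g b))
  (filterI (Jn_ae f) (Jn_ae g)) => w -> -> [fw gw].
by rewrite fw gw.
Qed.

Lemma Jn_cst n (c : R) : J (fun _ : cube n => c) = c *: one.
Proof.
apply: Lspace_ext; rewrite -[c *: one]addr0.
apply: filterS3 (Jn_ae (fun _ : cube n => c)) (Lrepr_lin c one 0)
  (filterI one_ae (Lrepr0 mu p1)) => w -> -> [-> ->].
by rewrite mulr1 addr0.
Qed.

Lemma Jn_ext n (f g : cube n -> R) : f =1 g -> J f = J g.
Proof. by move=> /funext ->. Qed.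

Lemma Jn_inj n (f g : cube n -> R) : J f = J g -> f =1 g.
Proof.
move=> fg b.
have h : \forall w \ae mu, f (coord n w) = g (coord n w).
  by apply: filterS2 (Jn_ae f) (Jn_ae g) => w <- <-; rewrite fg.
by have [w /(_ b)] := ae_ex (ae_upd n h); rewrite upd_same.
Qed.

(** Changing coordinate [n] leaves the right-hand side unchanged. *)
Lemma Jn_Jn_cst n m (f : cube n -> R) (g : cube m -> R) : n != m ->
  J f = J g -> exists c, forall b, f b = c.
Proof.
move=> nm fg.
have h : \forall w \ae mu, f (coord n w) = g (coord m w).
  by apply: filterS2 (Jn_ae f) (Jn_ae g) => w <- <-; rewrite fg.
have [w hw] := ae_ex (ae_upd n h).
by exists (g (coord m w)) => b; have := hw b; rewrite upd_same upd_other.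
Qed.

Lemma ge0_integral_act i (s : {perm cube i}) (F : Omega -> \bar R) :
  measurable_fun setT F -> (forall w, 0 <= F w)%E ->
  (\int[mu]_w F (act s w) = \int[mu]_w F w)%E.
Proof.
move=> mF F0.
transitivity (\int[pushforward mu (act s)]_w F w)%E.
  by rewrite ge0_integral_pushforward//; exact: measurable_act.
apply: eq_measure_integral => [|mf A mA _]; first exact: measurable_act.
exact: act_preserves.
Qed.

Lemma Lnorm_act i (s : {perm cube i}) (f : Omega -> R) :
  measurable_fun setT f ->
  ('N[mu]_p%:E[EFin \o (f \o act s)] = 'N[mu]_p%:E[EFin \o f])%E.
Proof.
move=> mf; rewrite unlock; congr (_ `^ _)%E.
pose F := (fun w : Omega => `|(f w)%:E| `^ p)%E.
apply: (@ge0_integral_act i s F) => [|w]; last exact: poweR_ge0.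
apply: (measurableT_comp (measurable_poweR p)).
by apply: measurableT_comp => //; exact/measurable_EFinP.
Qed.

Lemma comp_act_Lfun i (s : {perm cube i}) x :
  ((Lrepr x : Omega -> R) \o act s) \in Lfun mu p%:E.
Proof.
apply/andP; split; rewrite inE/=.
  apply: (@measurableT_comp _ _ _ _ _ _ (Lrepr x)) => //; exact: measurable_act.
rewrite /finite_norm (@Lnorm_act _ _ (Lrepr x))//.
by rewrite -(finite_norm_fine (Lrepr x)) ltry.
Qed.

(** The isometry of L^p induced by a permutation of one coordinate. *)
Definition Lact i (s : {perm cube i}) x : Lp :=
  Lclass (Lfun_Sub p1 (comp_act_Lfun s x)).

Lemma Lact_ae i (s : {perm cube i}) x :
  \forall w \ae mu, Lrepr (Lact s x) w = Lrepr x (act s w).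
Proof. exact: Lrepr_ae. Qed.

Lemma Lact_lin i (s : {perm cube i}) (a : R) x y :
  Lact s (a *: x + y) = a *: Lact s x + Lact s y.
Proof.
apply: Lspace_ext; apply: filterS3 (Lact_ae s (a *: x + y))
  (ae_act s (Lrepr_lin a x y)) (filterI (Lrepr_lin a (Lact s x) (Lact s y))
  (filterI (Lact_ae s x) (Lact_ae s y))) => w -> -> [-> [-> ->]].
by [].
Qed.

Lemma Lact_norm i (s : {perm cube i}) x : `|Lact s x| = `|x|.
Proof.
by rewrite [LHS]Lspace_norm_class [X in fine X]Lnorm_act.
Qed.

Lemma Lact_Jn i (s : {perm cube i}) (f : cube i -> R) :
  Lact s (J f) = J (f \o s).
Proof.
apply: Lspace_ext; apply: filterS3 (Lact_ae s (J f)) (ae_act s (Jn_ae f))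
  (Jn_ae (f \o s)) => w -> -> ->.
by rewrite /act upd_same.
Qed.

Lemma Lact_Jn_other i (s : {perm cube i}) j (f : cube j -> R) :
  i != j -> Lact s (J f) = J f.
Proof.
move=> ij.
apply: Lspace_ext; apply: filterS3 (Lact_ae s (J f)) (ae_act s (Jn_ae f))
  (Jn_ae f) => w -> -> ->.
by rewrite /act upd_other.
Qed.

End coordinate_functions.

Section coordinate_averages.
Variables (R : realType) (p : R) (p_gt1 : 1 < p).
Local Notation mu := (Omega_mu R).
Local Notation p1 := (lt1_le1e p_gt1).
Local Notation Lp := (LspaceType (Omega_mu R) (lt1_le1e p_gt1)).
Local Notation J := (Jn p_gt1).
Local Notation one := (one_Omega p_gt1 : Lp).
Implicit Types x y z : Lp.

HB.instance Definition _ i (s : {perm cube i}) :=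
  GRing.isLinear.Build R Lp Lp _ (@Lact R p p_gt1 i s) (Lact_lin s).

Lemma LactB i (s : {perm cube i}) x y : Lact s (x - y) = Lact s x - Lact s y.
Proof. exact: linearB. Qed.

Lemma Lact_one i (s : {perm cube i}) : Lact s one = one.
Proof.
by rewrite -[one]scale1r -(Jn_cst p_gt1 i) Lact_Jn; apply: Jn_ext.
Qed.

(** The conditional expectation given all coordinates but [i], written as an
    average of isometries. *)
Definition Lavg i x : Lp :=
  #|{perm cube i}|%:R^-1 *: \sum_(s : {perm cube i}) Lact s x.

Lemma Lavg_lin i : linear (Lavg i).
Proof.
move=> a x y; rewrite /Lavg scalerA mulrC -scalerA -scalerDr; congr (_ *: _).
rewrite scaler_sumr -big_split /=; apply: eq_bigr => s _.
exact: Lact_lin.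
Qed.

HB.instance Definition _ i :=
  GRing.isLinear.Build R Lp Lp _ (Lavg i) (Lavg_lin i).

Lemma card_perm_cube_gt0 i : (0 < #|{perm cube i}|)%N.
Proof. by apply/card_gt0P; exists 1%g. Qed.

Lemma Lavg_cst i (x y : Lp) : (forall s : {perm cube i}, Lact s x = y) ->
  Lavg i x = y.
Proof.
move=> xy; rewrite /Lavg (eq_bigr (fun=> y)) => [|s _]; last exact: xy.
rewrite sumr_const -(scaler_nat _ y) scalerA mulVf ?scale1r//.
by rewrite pnatr_eq0 -lt0n card_perm_cube_gt0.
Qed.

Lemma Lavg_norm i x : `|Lavg i x| <= `|x|.
Proof.
rewrite /Lavg normrZ ger0_norm ?invr_ge0// mulrC ler_pdivrMr; last first.
  by rewrite ltr0n card_perm_cube_gt0.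
rewrite (le_trans (ler_norm_sum _ _ _))// (eq_bigr (fun=> `|x|)) => [|s _].
  by rewrite sumr_const mulr_natr.
exact: Lact_norm.
Qed.

Lemma Lavg_Jn_other i j (f : cube j -> R) : i != j -> Lavg i (J f) = J f.
Proof. by move=> ij; apply: Lavg_cst => s; rewrite Lact_Jn_other. Qed.

Lemma Jn_sum n (I : Type) (r : seq I) (c : I -> R) (g : I -> cube n -> R) :
  J (fun b => \sum_(a <- r) c a * g a b) = \sum_(a <- r) c a *: (J (g a) : Lp).
Proof.
elim: r => [|a r IH].
  rewrite big_nil (Jn_ext p_gt1 (g := fun=> 0)) ?Jn_cst ?scale0r// => b.
  by rewrite big_nil.
by rewrite big_cons -IH -Jn_lin; apply: Jn_ext => b; rewrite big_cons.
Qed.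

Definition atom_fn k (a : cube k) : Lp := J (fun b => (b == a)%:R).

Lemma Jn_atoms k (f : cube k -> R) : J f = \sum_(a : cube k) f a *: atom_fn a.
Proof.
rewrite -Jn_sum; apply: Jn_ext => b.
rewrite (bigD1 b)//= eqxx mulr1 big1 ?addr0// => a ab.
by rewrite eq_sym (negPf ab) mulr0.
Qed.

(** Composing with the transposition that exchanges two points permutes the
    terms of the average. *)
Lemma Lavg_Jn i (f : cube i -> R) : exists c, Lavg i (J f) = c *: one.
Proof.
pose N : R := #|{perm cube i}|%:R^-1.
pose F b := \sum_(s : {perm cube i}) N * f (s b).
have F_cst b : F b = F point.
  rewrite /F (reindex_inj (mulgI (tperm b point))) /=.
  by apply: eq_bigr => s _; rewrite permM tpermL.
exists (F point); rewrite -(Jn_cst p_gt1 i).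
rewrite -(Jn_ext p_gt1 F_cst) /F Jn_sum /Lavg scaler_sumr.
by apply: eq_bigr => s _; rewrite Lact_Jn.
Qed.

End coordinate_averages.

(** * The space R_omega *)

Section R_omega_space.
Variables (R : realType) (p : R) (p_gt1 : 1 < p).
Local Notation mu := (Omega_mu R).
Local Notation p1 := (lt1_le1e p_gt1).
Local Notation Lp := (LspaceType (Omega_mu R) (lt1_le1e p_gt1)).
Local Notation J := (Jn p_gt1).
Local Notation one := (one_Omega p_gt1 : Lp).
Local Notation Romega := (@R_omega R p p_gt1 : set Lp).
Implicit Types x y z : Lp.

Lemma lin_span_subspace (V : normedModType R) (A : set V) :
  lin_subspace (lin_span A).
Proof.
split; first by exists 0, (fun=> 0), (fun=> 0); split; [case|rewrite big_ord0].
move=> c _ _ [n [a [v [Av ->]]]] [m [b [u [Au ->]]]].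
exists (n + m)%N,
  (fun i => match fintype.split i with inl j => c * a j | inr j => b j end),
  (fun i => match fintype.split i with inl j => v j | inr j => u j end).
split; first by move=> i; case: fintype.split.
rewrite big_split_ord scaler_sumr; congr (_ + _); apply: eq_bigr => i _.
  by rewrite -[lshift _ _]/(unsplit (inl i)) unsplitK scalerA.
by rewrite -[rshift _ _]/(unsplit (inr i)) unsplitK.
Qed.

Lemma R_omega_subspace : lin_subspace Romega.
Proof. exact/subspace_add_line/subspace_closure/lin_span_subspace. Qed.

Lemma cube_measurable n (f : cube n -> R) : measurable_fun setT f.
Proof. by move=> _ B _; rewrite setTI. Qed.

Lemma cube_Lfun n (r : R) (f : cube n -> R) :
  0 < r -> f \in Lfun (cube_mu R n) r%:E.
Proof.
move=> r0; have mf := cube_measurable f.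
apply/andP; split; rewrite inE //= /finite_norm.
pose C : R := \sum_(a : cube n) `|f a|.
have fC a : `|f a| <= C by rewrite /C (bigD1 a)//= lerDl sumr_ge0.
apply: (@le_lt_trans _ _ ('N[cube_mu R n]_r%:E[EFin \o cst C])%E); last first.
  have /andP[_] := Lfun_cst (cube_mu R n) C r.
  by rewrite inE.
rewrite unlock gt0_ler_poweR ?invr_ge0 ?(ltW r0)//
  ?in_itv/= ?leey ?integral_ge0//.
apply: ge0_le_integral => //=; try by move=> ? ? ?.
move=> w _; rewrite lee_fin ge0_ler_powR ?nnegrE ?(ltW r0)//.
by rewrite (le_trans (fC _))// ler_norm.
Qed.

Lemma Hn_sub_mean n (f : cube n -> R) : exists c, Hn p (fun b => f b - c).
Proof.
have fI : (cube_mu R n).-integrable setT (EFin \o f).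
  exact/Lfun1_integrable/cube_Lfun.
have p0 : 0 < p by rewrite (lt_trans ltr01).
exists (\int[cube_mu R n]_b f b); split; first exact: cube_Lfun.
have cI (c : R) : (cube_mu R n).-integrable setT (EFin \o cst c).
  exact/Lfun1_integrable/cube_Lfun.
under eq_integral do rewrite EFinB.
rewrite (integralB_EFin measurableT fI (cI _)).
set c := (\int[cube_mu R n]_b f b)%R.
have -> : (\int[cube_mu R n]_b (cst c b)%:E = c%:E)%E.
  rewrite (integral_cst _ _ (EFin c))// -[RHS]mule1; congr (_ * _)%E.
  exact: probability_setT.
by rewrite /c /Rintegral fineK ?subee//; exact: integrable_fin_num.
Qed.

Lemma R_omega_Jn n (f : cube n -> R) : Romega (J f).
Proof.
have [c Hf] := Hn_sub_mean f.
exists c => //; exists (J (fun b => f b - c)).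
  apply: subset_closure; exists 1, (fun=> 1), (fun=> J (fun b => f b - c)).
  split; last by rewrite big_ord1 scale1r.
  by move=> _; exists n => //; exists (fun b => f b - c).
rewrite -[c](mulr1) -(Jn_cst p_gt1 n).
have -> : J f = J (fun b => 1 * c + (f b - c)).
  by apply: Jn_ext => b; rewrite mul1r addrC subrK.
by rewrite Jn_lin mulr1 scale1r.
Qed.

Lemma R_omega_one : Romega one.
Proof.
by rewrite -[one]scale1r -(Jn_cst p_gt1 0); exact: R_omega_Jn.
Qed.

Definition Jsum n (f : forall k, cube k -> R) : Lp := \sum_(k < n) J (f k).

(** Padding with zeros lets sums of different lengths be added termwise. *)
Definition pad n (f : forall k, cube k -> R) k : cube k -> R :=
  if (k < n)%N then f k else fun=> 0.

Lemma Jn0 n : J (fun _ : cube n => 0) = 0.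
Proof. by rewrite Jn_cst scale0r. Qed.

Lemma Jsum_pad n m f : (n <= m)%N -> Jsum m (pad n f) = Jsum n f.
Proof.
move=> nm; rewrite /Jsum.
rewrite [RHS](big_ord_widen _ (fun k => J (f k) : Lp) nm) [RHS]big_mkcond /=.
by apply: eq_bigr => k _; rewrite /pad; case: ifP => // _; exact: Jn0.
Qed.

Lemma Jsum_subspace : lin_subspace [set x : Lp | exists n f, x = Jsum n f].
Proof.
split; first by exists 0, (fun _ => fun=> 0); rewrite /Jsum big_ord0.
move=> a _ _ [n [f ->]] [m [g ->]].
exists (maxn n m), (fun k b => a * pad n f b + pad m g b).
rewrite -(Jsum_pad f (leq_maxl n m)) -(Jsum_pad g (leq_maxr n m)).
rewrite /Jsum scaler_sumr -big_split; apply: eq_bigr => k _ /=.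
by rewrite Jn_lin.
Qed.

Lemma Jsum_Jn n (g : cube n -> R) : exists f, J g = Jsum n.+1 f.
Proof.
exists (@eqtype.dfwith nat (fun k => cube k -> R) (fun _ => fun=> 0) n g).
rewrite /Jsum (bigD1 ord_max)//= eqtype.dfwith_in big1 ?addr0// => k kn.
rewrite eqtype.dfwith_out ?Jn0//.
by apply: contraNN kn => /eqP nk; apply/eqP/val_inj.
Qed.

Lemma R_omega_approx x : Romega x -> forall e : R, 0 < e ->
  exists c n f, `|x - (c *: one + Jsum n f)| < e.
Proof.
move=> [c _ [y yX <-]] e e0.
have [_ [m [a [v [Av ->]]]] yz] := (closure_normP _ _).1 yX e e0.
have [n [f fE]] :
    [set x : Lp | exists n f, x = Jsum n f] (\sum_(i < m) a i *: v i).
  apply: subspace_sum Jsum_subspace _ => i.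
  apply: subspaceZ Jsum_subspace _.
  have [k _ [g _ <-]] := Av i.
  by have [f fE] := Jsum_Jn g; exists k.+1, f.
by exists c, n, f; rewrite opprD addrACA subrr add0r -fE.
Qed.

Definition Jrange i : set Lp := range (fun f : cube i -> R => J f : Lp).

Lemma Jrange_subspace i : lin_subspace (Jrange i).
Proof.
split; first by exists (fun=> 0) => //; rewrite Jn0.
move=> a _ _ [f _ <-] [g _ <-].
by exists (fun b => a * f b + g b) => //; rewrite Jn_lin.
Qed.

Lemma Jrange_fspan i : Jrange i =
  fspan [seq atom_fn p_gt1 a | a <- enum (cube i : finType)].
Proof.
apply/seteqP; split => [_ [f _ <-]|x].
  have -> : J f = \sum_(a <- enum (cube i : finType)) f a *: atom_fn p_gt1 a.
    by rewrite Jn_atoms big_enum.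
  elim: (enum _) => [|a r IH] /=; first by rewrite big_nil.
  rewrite big_cons; exists (f a) => //.
  by exists (\sum_(j <- r) f j *: atom_fn p_gt1 j).
elim: (enum _) x => [|a r IH] x /=.
  by move=> ->; exact: (Jrange_subspace i).1.
move=> [c _ [y /IH yJ <-]]; apply: (Jrange_subspace i).2 => //.
by exists (fun b => (b == a)%:R).
Qed.

Lemma closure_Jrange i : closure (Jrange i) `<=` Jrange i.
Proof. by rewrite Jrange_fspan; exact: closure_fspan. Qed.

(** For a finite sum only the [i]-th summand changes, and the range of [J] on
    the [i]-th cube is closed. *)
Lemma Lact_diff i (s : {perm cube i}) x : Romega x -> Jrange i (Lact s x - x).
Proof.
move=> Rx; apply: closure_Jrange; apply/closure_normP => e e0.
have e2 : 0 < e / 2 by rewrite divr_gt0.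
have [c [n [f xy]]] := R_omega_approx Rx e2.
pose y := c *: one + Jsum n f; rewrite -/y in xy; exists (Lact s y - y).
  rewrite /y Lact_lin Lact_one opprD addrACA subrr add0r.
  rewrite /Jsum linear_sum -sumrB /=.
  apply: subspace_sum (Jrange_subspace i) _ => k.
  case: (eqVneq i k) => [ik|ik]; last first.
    rewrite Lact_Jn_other// subrr; exact: (Jrange_subspace i).1.
  have [g ->] : exists g : cube i -> R, J (f k) = J g.
      by rewrite ik; exists (f k).
  rewrite Lact_Jn; apply: subspaceB (Jrange_subspace i) _ _;
    [by exists (g \o s)|by exists g].
have -> : Lact s x - x - (Lact s y - y) = Lact s (x - y) - (x - y).
  by rewrite LactB [in RHS]opprD !opprK addrACA opprD opprK.
rewrite (le_lt_trans (ler_normB _ _))// Lact_norm [ltRHS]splitr.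
exact: ltrD.
Qed.

(** If [f] is a sum of functions of separate coordinates, [e i] is the [i]-th
    summand up to a constant.  Differences are recorded instead of summands, so
    that no convergence is involved. *)
Definition increments (f : Omega -> R) (e : forall i, cube i -> R) := forall i,
  \forall w \ae mu, forall a : cube i,
    f (upd w a) = f w + e i a - e i (coord i w).

(** [Lact_diff] says how [x] varies under each permutation; comparing with the
    value of [x] at a fixed base point [o] of the cube makes this additive. *)
Lemma R_omega_increments x : Romega x -> exists e, increments (Lrepr x) e.
Proof.
move=> Rx.
suff h i : exists e : cube i -> R, \forall w \ae mu, forall a : cube i,
    Lrepr x (upd w a) = Lrepr x w + e a - e (coord i w).
  by exists (fun i => sval (cid (h i))) => i; exact: svalP (cid (h i)).
have {Rx} /choice[g gE] : forall s : {perm cube i}, exists g : cube i -> R,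
    \forall w \ae mu, Lrepr x (act s w) = Lrepr x w + g (coord i w).
  move=> s; have [g _ gE] := Lact_diff s Rx; exists g.
  have sx : Lact s x = 1 *: (J g : Lp) + x by rewrite scale1r gE subrK.
  apply: filterS3 (Lact_ae s x) (Lrepr_lin 1 (J g : Lp) x)
    (Jn_ae p_gt1 g) => w <-.
  by rewrite sx => -> ->; rewrite mul1r addrC.
have /ae_forall_fin/(ae_upd i) := gE.
pose o : cube i := point.
pose e a := g (tperm o a) o.
move=> h; exists e; apply: filterS h => w h a.
have {}h b : Lrepr x (upd w b) = Lrepr x (upd w o) + e b.
  by have := h o (tperm o b); rewrite /act upd_same tpermL upd_upd.
have := h (coord i w); rewrite upd_id (h a) => ->; ring.
Qed.

(** Averaging over a coordinate [i != k] fixes [x] and turns the [i]-th summand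
    of an approximation into a constant, which is a function of coordinate [k],
    without worsening the approximation. *)
Lemma average_approx k x :
  (forall i (s : {perm cube i}), i != k -> Lact s x = x) ->
  forall n f (g : cube k -> R),
  exists h : cube k -> R, `|x - J h| <= `|x - (J g + Jsum n f)|.
Proof.
move=> xinv; elim=> [|n IH] f g.
  by exists g; rewrite /Jsum big_ord0 addr0.
have -> : J g + Jsum n.+1 f = J (f n) + J g + Jsum n f :> Lp.
  by rewrite /Jsum big_ord_recr /= addrA addrAC [J g + _]addrC.
case: (eqVneq n k) => [nk|nk].
  have [h ->] : exists h : cube k -> R, J (f n) = J h.
    by rewrite -nk; exists (f n).
  have [h' h'P] := IH f (fun b => 1 * h b + g b).
  by exists h'; rewrite (le_trans h'P)// Jn_lin scale1r.
have [c cE] := Lavg_Jn p_gt1 (f n).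
have [h hP] := IH f (fun b => 1 * c + g b).
exists h; apply: (le_trans hP); apply: (le_trans _ (Lavg_norm n _)).
rewrite Jn_lin Jn_cst scale1r.
have xn : Lavg n x = x by apply: Lavg_cst => s; exact: xinv.
have Sn : Lavg n (Jsum n f) = Jsum n f.
  rewrite /Jsum linear_sum; apply: eq_bigr => i _ /=.
  by rewrite Lavg_Jn_other// gtn_eqF.
by rewrite linearB !linearD /= xn Sn cE Lavg_Jn_other.
Qed.

(** An element that does not feel permutations of the coordinates other than [k]
    is approximated by functions of coordinate [k]. *)
Lemma single_coordinate k x : Romega x ->
  (forall i (s : {perm cube i}), i != k -> Lact s x = x) ->
  exists h : cube k -> R, x = J h.
Proof.
move=> Rx xinv; suff [h _ <-] : Jrange k x by exists h.
apply: closure_Jrange; apply/closure_normP => e e0.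
have [c [n [f xe]]] := R_omega_approx Rx e0.
have [h hP] := average_approx xinv n f (fun=> c).
exists (J h); first by exists h.
by rewrite (le_lt_trans hP)// Jn_cst.
Qed.

End R_omega_space.

(** * Disjoint supports in R_omega *)

Section disjoint_supports.
Variables (R : realType) (p : R) (p_gt1 : 1 < p).
Local Notation mu := (Omega_mu R).
Local Notation p1 := (lt1_le1e p_gt1).
Local Notation Lp := (LspaceType (Omega_mu R) (lt1_le1e p_gt1)).
Local Notation J := (Jn p_gt1).
Local Notation one := (one_Omega p_gt1 : Lp).
Local Notation Romega := (@R_omega R p p_gt1 : set Lp).
Implicit Types x y z : Lp.

Definition constant_on n (f : cube n -> R) := forall a b, f a = f b.

Lemma not_constant_on n (f : cube n -> R) :
  ~ constant_on f -> exists a b, f a != f b.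
Proof.
move=> nf; apply: contrapT => h; apply: nf => a b; apply/eqP/negPn/negP => ab.
by apply: h; exists a, b.
Qed.

Lemma increments_invariant x e i (s : {perm cube i}) :
  increments (Lrepr x) e -> constant_on (e i) -> Lact s x = x.
Proof.
move=> inc ei; apply: Lspace_ext.
apply: filterS2 (Lact_ae s x) (inc i) => w -> h.
by rewrite /act h (ei _ (coord i w)) addrK.
Qed.

Lemma single_or_two x e : Romega x -> increments (Lrepr x) e ->
  (exists k (h : cube k -> R), x = J h) \/
  (exists i j, [/\ i != j, ~ constant_on (e i) & ~ constant_on (e j)]).
Proof.
move=> Rx inc.
have single k : (forall i, i != k -> constant_on (e i)) ->
    exists k (h : cube k -> R), x = J h.
  move=> ek; exists k; apply: single_coordinate => // i s ik.
  exact: increments_invariant inc (ek i ik).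
have [[k nk]|all_cst] := pselect (exists k, ~ constant_on (e k)); last first.
  left; apply: (single 0) => i _; apply: contrapT => ni; apply: all_cst.
  by exists i.
have [[i [ik ni]]|others] := pselect (exists i, i != k /\ ~ constant_on (e i)).
  by right; exists i, k.
left; apply: (single k) => i ik; apply: contrapT => ni; apply: others.
by exists i.
Qed.

Lemma grid_id w i j : upd (upd w (coord i w)) (coord j w) = w.
Proof. by rewrite upd_id upd_id. Qed.

Lemma ae_grid (P : set Omega) i j : (\forall w \ae mu, P w) ->
  \forall w \ae mu, forall (a : cube i) (b : cube j), P (upd (upd w a) b).
Proof. by move=> /(ae_upd j) /(ae_upd i). Qed.

Lemma increments_grid (f : Omega -> R) (e : forall i, cube i -> R) i j :
  i != j -> increments f e ->
  \forall w \ae mu, forall (a : cube i) (b : cube j),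
    f (upd (upd w a) b) =
      f w + (e i a - e i (coord i w)) + (e j b - e j (coord j w)).
Proof.
move=> ij inc; apply: filterS2 (inc i) (ae_upd i (inc j)) => w hi hj a b.
by rewrite hj hi upd_other// !addrA.
Qed.

Section grid.
Context (A B : Type) (a a' : A) (b b' : B).

Definition additive_on_grid (F : A -> B -> R) :=
  forall (x x' : A) (y y' : B), F x y + F x' y' = F x y' + F x' y.

Variable F : A -> B -> R.
Hypothesis addF : additive_on_grid F.
Hypotheses (Fa : F a b != F a' b) (Fb : F a b != F a b').

(** On each row [x], the values of [F] at [b] and [b'] differ, so one of them is
    nonzero and forces a zero of [H]; but [H], being additive, takes the same
    value at [b] and [b'] on all rows.  The same holds for columns. *)
Lemma grid_vanish (H : A -> B -> R) : additive_on_grid H ->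
  (forall (x : A) (y : B), F x y * H x y = 0) ->
  H a b = 0 -> H a b' = 0 -> H a' b = 0 -> forall (x : A) (y : B), H x y = 0.
Proof.
move=> addH FH H0 H01 H10.
have Hx (x : A) : H x b = 0.
  have e : H x b = H x b' by have := addH a x b b'; rewrite H0 H01 !add0r.
  have := FH x b; have := FH x b'; rewrite -e => /eqP + /eqP.
  rewrite !mulf_eq0 => /orP[/eqP F1|/eqP//] /orP[/eqP F2|/eqP//].
  have := addF x a b b'; rewrite F1 F2 !add0r => /esym/eqP.
  by rewrite (negPf Fb).
have Hy (y : B) : H a y = 0.
  have e : H a y = H a' y by have := addH a a' y b; rewrite H0 H10 addr0 add0r.
  have := FH a y; have := FH a' y; rewrite -e => /eqP + /eqP.
  rewrite !mulf_eq0 => /orP[/eqP F1|/eqP//] /orP[/eqP F2|/eqP//].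
  have := addF a a' y b; rewrite F1 F2 add0r addr0 => /esym/eqP.
  by rewrite (negPf Fa).
by move=> x y; have := addH x a y b; rewrite H0 Hx Hy !addr0.
Qed.

(** Adjacent cells of the grid spanned by [a], [a'], [b], [b'] cannot both be
    zeros of [F], so [F] is nonzero on a diagonal; there [G] and [H] vanish, and
    by additivity each takes opposite values on the other diagonal.  As [G * H]
    is zero, one of [G] and [H] vanishes on the four cells. *)
Lemma grid_alternative (G H : A -> B -> R) :
  additive_on_grid G -> additive_on_grid H ->
  (forall (x : A) (y : B), F x y * G x y = 0) ->
  (forall (x : A) (y : B), F x y * H x y = 0) ->
  (forall (x : A) (y : B), G x y * H x y = 0) ->
  (forall (x : A) (y : B), G x y = 0) \/ (forall (x : A) (y : B), H x y = 0).
Proof.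
move=> addG addH FG FH GH.
have nz (x : A) (y : B) : F x y != 0 -> G x y = 0 /\ H x y = 0.
  move=> Fxy; split; apply/eqP.
    by have /eqP := FG x y; rewrite mulf_eq0 (negPf Fxy).
  by have /eqP := FH x y; rewrite mulf_eq0 (negPf Fxy).
have gG := addG a a' b b'; have gH := addH a a' b b'; have gF := addF a a' b b'.
have [F0|/nz[G0 H0]] := eqVneq (F a b) 0.
  have /nz[G1 H1] : F a' b != 0 by rewrite -F0 eq_sym.
  have /nz[G2 H2] : F a b' != 0 by rewrite -F0 eq_sym.
  have /eqP := GH a b; rewrite mulf_eq0 => /orP[]/eqP Z.
    by left; apply: grid_vanish.
  by right; apply: grid_vanish.
have [F0'|/nz[G1 H1]] := eqVneq (F a' b') 0.
  have /nz[G1 H1] : F a' b != 0.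
    apply/eqP => Z; move: Fb; rewrite -subr_eq0 => /eqP; lra.
  have /nz[G2 H2] : F a b' != 0.
    apply/eqP => Z; move: Fa; rewrite -subr_eq0 => /eqP; lra.
  by left; apply: grid_vanish.
have /eqP := GH a b'; rewrite mulf_eq0 => /orP[]/eqP Z; [left|right];
  apply: grid_vanish => //; lra.
Qed.

End grid.

Lemma increments_additive (f : Omega -> R) (e : forall i, cube i -> R) i j :
  i != j -> increments f e -> \forall w \ae mu,
  additive_on_grid (fun (u : cube i) (v : cube j) => f (upd (upd w u) v)).
Proof.
move=> ij inc; apply: filterS (increments_grid ij inc) => w h u u' v v'.
by rewrite !h; ring.
Qed.

Lemma increments_neq (f : Omega -> R) (e : forall i, cube i -> R) i j
    (a a' : cube i) (b b' : cube j) :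
  i != j -> increments f e -> e i a != e i a' -> e j b != e j b' ->
  \forall w \ae mu,
    f (upd (upd w a) b) != f (upd (upd w a') b) /\
    f (upd (upd w a) b) != f (upd (upd w a) b').
Proof.
move=> ij inc aa' bb'; apply: filterS (increments_grid ij inc) => w h.
rewrite !h; split; rewrite -subr_eq0.
  by move: aa'; rewrite -subr_eq0; congr (_ != _); ring.
by move: bb'; rewrite -subr_eq0; congr (_ != _); ring.
Qed.

(** If [x] varied with two coordinates [i] and [j], one of [y] and [z] would
    vanish on almost every grid in the directions [i] and [j].  When [y] varies
    with [i] or [j] it vanishes on no grid, so [z] is zero.  Otherwise [y] is
    constant on grids and vanishes wherever [x] does not, so [y] is zero. *)
Lemma three_disjoint x y z : Romega x -> Romega y -> Romega z ->
  Ldisjoint x y -> Ldisjoint x z -> Ldisjoint y z -> y <> 0 -> z <> 0 ->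
  exists k (h : cube k -> R), x = J h.
Proof.
move=> Rx Ry Rz xy xz yz y0 z0.
have [ex ix] := R_omega_increments Rx.
have [//|[i [j [ij ni nj]]]] := single_or_two Rx ix.
have [a [a' aa']] := not_constant_on ni.
have [b [b' bb']] := not_constant_on nj.
exfalso.
have [ey iy] := R_omega_increments Ry; have [ez iz] := R_omega_increments Rz.
have nx := increments_neq ij ix aa' bb'.
have gxy := ae_grid i j xy.
have [[ci cj]|nc] := pselect (constant_on (ey i) /\ constant_on (ey j)).
  apply: y0; apply: Lspace_eq0.
  apply: filterS3 nx gxy (increments_grid ij iy) => w [nw _] hxy hy.
  have yE (u : cube i) (v : cube j) : Lrepr y (upd (upd w u) v) = Lrepr y w.
    by rewrite hy (ci _ (coord i w)) (cj _ (coord j w)) !subrr !addr0.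
  have := hxy a b; have := hxy a' b; rewrite !yE => /eqP + /eqP.
  rewrite !mulf_eq0 => /orP[/eqP F1|/eqP//] /orP[/eqP F2|/eqP//].
  by rewrite F1 F2 eqxx in nw.
apply: z0; apply: Lspace_eq0.
have add := ae_and (increments_additive ij ix)
  (ae_and (increments_additive ij iy) (increments_additive ij iz)).
have dis := ae_and gxy (ae_and (ae_grid i j xz) (ae_grid i j yz)).
have := ae_and (ae_and nx (increments_grid ij iy)) (ae_and add dis).
apply: filterS => w [[[n1 n2] hy] [[addx [addy addz]] [dxy [dxz dyz]]]].
have [Y0|Z0] := grid_alternative addx n1 n2 addy addz dxy dxz dyz; last first.
  by have := Z0 (coord i w) (coord j w); rewrite grid_id.
exfalso; apply: nc.
have yE u v : Lrepr y w + (ey i u - ey i (coord i w)) +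
    (ey j v - ey j (coord j w)) = 0 by rewrite -hy; exact: Y0.
split=> u v.
  by have := yE u b; have := yE v b; lra.
by have := yE a u; have := yE a v; lra.
Qed.

(** Additivity on a 2 by 2 grid is incompatible with the values 0 and 1 when
    both coordinates matter: the two neighbours of a cell with value [t] would
    have the value [1 - t], and the opposite cell the value [2 - 3 * t]. *)
Lemma idempotent_single x : Romega x -> Ldisjoint x (one - x) ->
  exists k (h : cube k -> R), x = J h.
Proof.
move=> Rx xx.
have [e inc] := R_omega_increments Rx.
have [//|[i [j [ij ni nj]]]] := single_or_two Rx inc.
have [a [a' aa']] := not_constant_on ni.
have [b [b' bb']] := not_constant_on nj.
exfalso.
have x01 : \forall w \ae mu, Lrepr x w = 0 \/ Lrepr x w = 1.
  have := Lrepr_lin (-1) x one; rewrite scaleN1r addrC => xE.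
  apply: filterS3 xx xE (one_ae p_gt1) => w h h1 h2.
  move/eqP: h; rewrite h1 h2 mulf_eq0 => /orP[]/eqP; first by left.
  by move=> h; right; lra.
have [w [[add [n1 n2]] h]] := ae_ex (ae_and (ae_and (increments_additive ij inc)
  (increments_neq ij inc aa' bb')) (ae_grid i j x01)).
have := add a a' b b'; move: n1 n2; case: (h a b) (h a' b) (h a b') (h a' b') =>
  -> [] -> [] -> [] ->; rewrite ?eqxx// => _ _; lra.
Qed.

Lemma Ldisjoint_Jn n (f g : cube n -> R) : Ldisjoint (J f : Lp) (J g) ->
  forall b, f b * g b = 0.
Proof.
move=> fg b.
have h : \forall w \ae mu, f (coord n w) * g (coord n w) = 0.
  by apply: filterS3 fg (Jn_ae p_gt1 f) (Jn_ae p_gt1 g) => w h h1 h2;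
    rewrite -h1 -h2.
by have [w /(_ b)] := ae_ex (ae_upd n h); rewrite upd_same.
Qed.

(** All pairs of values of two coordinates occur on almost every grid. *)
Lemma Ldisjoint_Jn_coord n m (f : cube n -> R) (g : cube m -> R) :
  Ldisjoint (J f : Lp) (J g) -> J f <> 0 -> J g <> 0 -> n = m.
Proof.
move=> fg f0 g0; apply/eqP/negPn/negP => nm.
have h : \forall w \ae mu, f (coord n w) * g (coord m w) = 0.
  by apply: filterS3 fg (Jn_ae p_gt1 f) (Jn_ae p_gt1 g) => w h h1 h2;
    rewrite -h1 -h2.
have [w hw] := ae_ex (ae_grid n m h).
apply: f0; rewrite -(Jn0 p_gt1 n); apply: Jn_ext => a.
apply/eqP/negPn/negP => fa.
apply: g0; rewrite -(Jn0 p_gt1 m); apply: Jn_ext => b.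
have := hw a b; rewrite upd_other 1?eq_sym// !upd_same => /eqP.
by rewrite mulf_eq0 (negPf fa) => /eqP.
Qed.

End disjoint_supports.

(** * Isometries of R_omega *)

Section isometries.
Variables (R : realType) (p : R) (p_gt1 : 1 < p).
Local Notation mu := (Omega_mu R).
Local Notation p1 := (lt1_le1e p_gt1).
Local Notation Lp := (LspaceType (Omega_mu R) (lt1_le1e p_gt1)).
Local Notation J := (Jn p_gt1).
Local Notation one := (one_Omega p_gt1 : Lp).
Local Notation Romega := (@R_omega R p p_gt1 : set Lp).
Local Notation atom := (atom_fn p_gt1).
Implicit Types x y z : Lp.

Lemma sum_atoms k : \sum_(a : cube k) atom a = one.
Proof.
rewrite -[RHS]scale1r -(Jn_cst p_gt1 k) Jn_atoms.
by apply: eq_bigr => a _; rewrite scale1r.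
Qed.

Lemma Jn_neq0 k (h : cube k -> R) : J h <> 0 -> exists b, h b != 0.
Proof.
move=> h0; apply: contrapT => nb; apply: h0; rewrite -(Jn0 p_gt1 k).
by apply: Jn_ext => b; apply/eqP/negPn/negP => hb; apply: nb; exists b.
Qed.

Lemma atom_neq0 k (a : cube k) : atom a <> 0.
Proof.
rewrite -(Jn0 p_gt1 k) => /Jn_inj /(_ a)/eqP.
by rewrite eqxx oner_eq0.
Qed.

Lemma R_omega_atom k (a : cube k) : Romega (atom a).
Proof. exact: R_omega_Jn. Qed.

Lemma atom_disjoint k (a a' : cube k) : a != a' -> Ldisjoint (atom a) (atom a').
Proof.
move=> aa'; apply: filterS2 (Jn_ae p_gt1 (fun b => (b == a)%:R))
  (Jn_ae p_gt1 (fun b => (b == a')%:R)) => w -> ->.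
by case: eqVneq => [->|_]; rewrite ?(negPf aa') ?mulr0 ?mul0r.
Qed.

Lemma disjoint_family_injection k m (h : cube k -> cube m -> R) :
  (forall a, exists b, h a b != 0) ->
  (forall a a' b, a != a' -> h a b * h a' b = 0) ->
  exists2 psi : cube k -> cube m, injective psi & forall a, h a (psi a) != 0.
Proof.
move=> /choice[psi psiP] dis; exists psi => // a a' aa'.
apply/eqP/negPn/negP => /(dis _ _ (psi a))/eqP.
by rewrite mulf_eq0 (negPf (psiP a)) aa' (negPf (psiP a')).
Qed.

Lemma card_cube k : #|{: cube k}| = (2 ^ k.+1)%N.
Proof.
transitivity #|{: {ffun 'I_k.+1 -> bool}}| => //.
by rewrite card_ffun card_bool card_ord.
Qed.

Lemma injection_leq k m (psi : cube k -> cube m) : injective psi -> (k <= m)%N.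
Proof.
by move=> /leq_card; rewrite !card_cube leq_exp2l.
Qed.

Section isometry.
Hypothesis p_neq2 : p != 2.
Variable U : Lp -> Lp.
Hypothesis isoU : surjective_linear_isometry (V := LpOmega p_gt1) Romega U.

Lemma iso_lin (a : R) x y : Romega x -> Romega y ->
  U (a *: x + y) = a *: U x + U y.
Proof. by case: isoU => lin _ _; exact: lin. Qed.

Lemma iso_norm x : Romega x -> `|U x| = `|x|.
Proof. by case: isoU => _ nrm _; exact: nrm. Qed.

Lemma iso_stable x : Romega x -> Romega (U x).
Proof. by case: isoU => _ _ UE Rx; rewrite -UE; exists x. Qed.

Lemma iso0 : U 0 = 0.
Proof.
apply/eqP; rewrite -normr_eq0 iso_norm ?normr0//.
exact: (R_omega_subspace p_gt1).1.
Qed.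

Lemma iso_eq0 x : Romega x -> U x = 0 -> x = 0.
Proof.
by move=> Rx Ux; apply/eqP; rewrite -normr_eq0 -iso_norm// Ux normr0.
Qed.

Lemma isoZ (a : R) x : Romega x -> U (a *: x) = a *: U x.
Proof.
move=> Rx; rewrite -[a *: x]addr0 iso_lin ?iso0 ?addr0//.
exact: (R_omega_subspace p_gt1).1.
Qed.

Lemma isoB x y : Romega x -> Romega y -> U (x - y) = U x - U y.
Proof. by move=> Rx Ry; rewrite addrC -scaleN1r iso_lin// scaleN1r addrC. Qed.

Lemma isoD x y : Romega x -> Romega y -> U (x + y) = U x + U y.
Proof. by move=> Rx Ry; have := iso_lin 1 Rx Ry; rewrite !scale1r. Qed.

Lemma iso_sum (I : Type) (r : seq I) (F : I -> Lp) : (forall i, Romega (F i)) ->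
  U (\sum_(i <- r) F i) = \sum_(i <- r) U (F i).
Proof.
move=> RF; elim: r => [|i r IH]; first by rewrite !big_nil iso0.
rewrite !big_cons isoD// ?IH//.
by apply: subspace_sum => //; exact: R_omega_subspace.
Qed.

Lemma iso_Jn k (f : cube k -> R) :
  U (J f) = \sum_(a : cube k) f a *: U (atom a).
Proof.
rewrite Jn_atoms iso_sum => [|a]; last first.
  by apply: subspaceZ (R_omega_subspace p_gt1) _; exact: R_omega_atom.
by apply: eq_bigr => a _; rewrite isoZ//; exact: R_omega_atom.
Qed.

Lemma iso_disjoint x y : Romega x -> Romega y ->
  Ldisjoint x y -> Ldisjoint (U x) (U y).
Proof.
move=> Rx Ry /(LdisjointP _ _ p_neq2) xy; apply/(LdisjointP _ _ p_neq2).
rewrite -isoD// -isoB// !iso_norm//.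
  by apply: subspaceB => //; exact: R_omega_subspace.
by apply: subspaceD => //; exact: R_omega_subspace.
Qed.

Lemma iso_atom_neq0 k (a : cube k) : U (atom a) <> 0.
Proof. by move=> /(iso_eq0 (R_omega_atom a)); exact: atom_neq0. Qed.

Lemma iso_atom_disjoint k (a a' : cube k) :
  a != a' -> Ldisjoint (U (atom a)) (U (atom a')).
Proof.
by move=> /atom_disjoint; apply: iso_disjoint; exact: R_omega_atom.
Qed.

Lemma iso_inverse : exists V : Lp -> Lp,
  [/\ surjective_linear_isometry (V := LpOmega p_gt1) Romega V,
      forall x, Romega x -> V (U x) = x & forall y, Romega y -> U (V y) = y].
Proof.
have [_ _ UE] := isoU.
have inv y : exists x, Romega y -> Romega x /\ U x = y.
  have [Ry|] := pselect (Romega y); last by exists 0.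
  by move: (Ry); rewrite -{1}UE => -[x Rx <-]; exists x.
have [V VP] := choice inv.
have VR y : Romega y -> Romega (V y) by move=> /VP[].
have UV y : Romega y -> U (V y) = y by move=> /VP[].
have VU x : Romega x -> V (U x) = x.
  move=> Rx; have RUx := iso_stable Rx; apply/eqP; rewrite -subr_eq0.
  apply/eqP/iso_eq0; last by rewrite isoB ?UV ?subrr//; exact: VR.
  by apply: subspaceB (VR _ _) _ => //; exact: R_omega_subspace.
exists V; split => //; split.
- move=> a x y Rx Ry.
  have RV := R_omega_subspace p_gt1.
  rewrite -[in LHS](UV _ Rx) -[in LHS](UV _ Ry) -iso_lin ?VU//; try exact: VR.
  by apply: RV.2; exact: VR.
- by move=> x Rx; rewrite -[in RHS](UV _ Rx) iso_norm//; exact: VR.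
- apply/seteqP; split => [_ [y Ry <-]|x Rx]; first exact: VR.
  by exists (U x); [exact: iso_stable|exact: VU].
Qed.

(** The images of the indicators of the points of a cube are nonzero and have
    disjoint supports.  So once each depends on one coordinate, this is the same
    coordinate [m] for all, and picking a point [psi a] in each support embeds
    the [k]-th cube into the [m]-th one. *)
Lemma common_coordinate k :
  (forall a : cube k, exists m (h : cube m -> R), U (atom a) = J h) ->
  exists m, (k <= m)%N /\ exists2 h : cube k -> cube m -> R,
    forall a, U (atom a) = J (h a) &
    exists2 psi, injective psi &
      forall a b, (h a (psi b) != 0) = (a == b).
Proof.
move=> single.
have U0 := @iso_atom_neq0 k; have Udis := @iso_atom_disjoint k.
have [m [h0 h0E]] := single point.
have /choice[h hE] : forall a : cube k,
    exists h : cube m -> R, U (atom a) = J h.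
  move=> a; have [->|na] := eqVneq a point; first by exists h0.
  have [m' [h hE]] := single a.
  have mm' : m' = m.
    apply: (Ldisjoint_Jn_coord (p_gt1 := p_gt1) (f := h) (g := h0)).
    - by rewrite -hE -h0E; exact: Udis.
    - by rewrite -hE.
    - by rewrite -h0E.
  by rewrite -mm'; exists h.
have dis a a' b : a != a' -> h a b * h a' b = 0.
  move=> aa'; apply: (Ldisjoint_Jn (p_gt1 := p_gt1)).
  by rewrite -!hE; exact: Udis.
have hn0 a : exists b, h a b != 0 by apply: Jn_neq0; rewrite -hE.
have [psi psi_inj psiP] := disjoint_family_injection hn0 dis.
exists m; split; first exact: injection_leq psi_inj.
exists h => //; exists psi => // a b.
have [->|ab] := eqVneq a b; first exact: psiP.
have /eqP := dis a b (psi b) ab.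
by rewrite mulf_eq0 (negPf (psiP b)) orbF => ->.
Qed.

Lemma iso_Jn_range k m (h : cube k -> cube m -> R) :
  (forall a, U (atom a) = J (h a)) -> forall f,
  U (J f) = J (fun b => \sum_a f a * h a b).
Proof.
by move=> hE f; rewrite iso_Jn Jn_sum; apply: eq_bigr => a _; rewrite hE.
Qed.

(** The [k]-th cube has at least three points because of [0 < k], which is what
    the lemma on three disjoint supports requires. *)
Lemma iso_one_range k : (0 < k)%N ->
  exists m, (k <= m)%N /\ exists h : cube m -> R, U one = J h.
Proof.
move=> k0.
have [a|m [km [h hE _]]] := @common_coordinate k.
  have [a1 [a2 [n1 n2 n12]]] : exists a1 a2, [/\ a != a1, a != a2 & a1 != a2].
    have : (1 < #|[set~ a]%SET|)%N.
      rewrite cardsC1 card_cube -subn1 ltn_subRL.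
      by rewrite -{1}[(1 + 1)%N]/(2 ^ 1)%N ltn_exp2l.
    move=> /card_gt1P[a1 [a2 []]]; rewrite !inE => n1 n2 n12.
    by exists a1, a2; split; rewrite // eq_sym.
  have RU (b : cube k) : Romega (U (atom b)) by apply/iso_stable/R_omega_atom.
  have U0 := @iso_atom_neq0 k; have UD := @iso_atom_disjoint k.
  exact: (three_disjoint (RU a) (RU a1) (RU a2)) (UD _ _ n1) (UD _ _ n2)
    (UD _ _ n12) (U0 _) (U0 _).
exists m; split => //; exists (fun b => \sum_a 1 * h a b).
by rewrite -(iso_Jn_range hE) Jn_cst scale1r.
Qed.

(** The image of 1 depends only on a coordinate [m], and also only on another
    coordinate [m' > m]. *)
Lemma iso_one : exists2 eps : R, eps = -1 \/ eps = 1 & U one = eps *: one.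
Proof.
have [m [m0 [f fE]]] := iso_one_range (ltn0Sn 0).
have [m' [mm' [g gE]]] := iso_one_range (ltn0Sn m).
have [c fc] : exists c, forall b, f b = c.
  apply: (Jn_Jn_cst (p_gt1 := p_gt1) (m := m') (g := g)); last by rewrite -fE.
  by rewrite ltn_eqF.
have Uone : U one = c *: one by rewrite fE -(Jn_cst p_gt1 m); apply: Jn_ext.
exists c => //.
have one0 : `|one| != 0.
  rewrite normr_eq0; apply/eqP; rewrite -[one]scale1r -(Jn_cst p_gt1 0).
  by rewrite -(Jn0 p_gt1 0) => /Jn_inj /(_ point)/eqP; rewrite oner_eq0.
have := iso_norm (R_omega_one p_gt1); rewrite Uone normrZ => /eqP.
rewrite -subr_eq0 -{2}[`|one|]mul1r -mulrBl mulf_eq0 (negPf one0) orbF subr_eq0.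
by rewrite eqr_norml ler01 andbT orbC => /orP[]/eqP; [left|right].
Qed.

(** Since 1 is mapped to [eps], the image of an indicator is [eps] times an
    indicator: its support is disjoint from that of the image of the
    complementary indicator. *)
Lemma iso_atom_single k (a : cube k) :
  exists m (h : cube m -> R), U (atom a) = J h.
Proof.
have [eps epsE Uone] := iso_one.
have eps2 : eps * eps = 1 by case: epsE => ->; ring.
have Ra := R_omega_atom a; have R1 := R_omega_one p_gt1.
have Rsub := R_omega_subspace p_gt1.
have [] := @idempotent_single R p p_gt1 (eps *: U (atom a)).
- by apply: subspaceZ => //; exact: iso_stable.
- have -> : one - eps *: U (atom a) = eps *: U (one - atom a).
    by rewrite isoB// Uone scalerBr scalerA eps2 scale1r.
  rewrite -!isoZ//; last exact: subspaceB.
  apply: iso_disjoint.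
  + exact: subspaceZ.
  + by apply: subspaceZ => //; exact: subspaceB.
  + rewrite -(sum_atoms k) (bigD1 a)//= addrAC subrr add0r.
    have -> : eps *: atom a = J (fun b => eps * (b == a)%:R + 0).
      by rewrite Jn_lin Jn0 addr0.
    have -> : eps *: (\sum_(b | b != a) atom b) =
        J (fun b => eps * (b != a)%:R + 0) :> Lp.
      rewrite Jn_lin Jn0 addr0 Jn_atoms big_mkcond /=; congr (_ *: _).
      by apply: eq_bigr => b _; case: eqP; rewrite ?scale1r ?scale0r.
    have h1 := Jn_ae p_gt1 (fun b => eps * (b == a)%:R + 0).
    have h2 := Jn_ae p_gt1 (fun b => eps * (b != a)%:R + 0).
    apply: filterS2 h1 h2 => w -> ->.
    by case: (_ == a); rewrite /= !addr0 ?mulr0 ?mul0r.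
- move=> m [h hE]; exists m, (fun b => eps * h b + 0).
  by rewrite Jn_lin Jn0 addr0 -hE scalerA eps2 scale1r.
Qed.

Lemma iso_range k : exists m, (k <= m)%N /\ exists2 h : cube k -> cube m -> R,
    forall a, U (atom a) = J (h a) &
    exists2 psi, injective psi &
      forall a b, (h a (psi b) != 0) = (a == b).
Proof. by apply: common_coordinate => a; exact: iso_atom_single. Qed.

End isometry.

Lemma atom_not_constant k (a : cube k) (c : R) :
  ~ (forall b, (b == a)%:R = c).
Proof.
move=> ac; have := ac a; rewrite eqxx => c1.
have : (0 < #|[set~ a]%SET|)%N.
  by rewrite cardsC1 card_cube -subn1 subn_gt0 -{1}[1%N]/(2 ^ 0)%N ltn_exp2l.
move=> /card_gt0P[b]; rewrite !inE => ba.
by have /eqP := ac b; rewrite (negPf ba) -c1 eq_sym oner_eq0.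
Qed.

(** Coordinate [k] is mapped to some [m >= k], and the inverse maps [m] to some
    [m' >= m].  As the composition is the identity, [m' = k]. *)
Lemma iso_coordinate (p_neq2 : p != 2) (U : Lp -> Lp)
    (isoU : surjective_linear_isometry (V := LpOmega p_gt1) Romega U) k :
  exists2 h : cube k -> cube k -> R,
    forall a, U (atom a) = J (h a) &
    exists2 psi, injective psi &
      forall a b, (h a (psi b) != 0) = (a == b).
Proof.
have [V [isoV VU _]] := iso_inverse isoU.
have [m [km hP]] := iso_range p_neq2 isoU k.
have [m' [mm' [g gE _]]] := iso_range p_neq2 isoV m.
suff mk : m = k by move: hP; rewrite mk.
case: hP => h hE _.
apply/eqP; rewrite eqn_leq km andbT (leq_trans mm')// leq_eqVlt.
apply/orP; left; apply/negPn/negP => m'k; rewrite eq_sym in m'k.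
have := VU _ (R_omega_atom (point : cube k)).
rewrite hE (iso_Jn_range isoV gE) => /esym/(Jn_Jn_cst m'k)[c].
exact: atom_not_constant.
Qed.

(** The supports of the images of the points are disjoint and as numerous as the
    points of the cube, so each is a single point; the value there is [eps]
    because the images add up to the image of 1. *)
Lemma iso_bijection (p_neq2 : p != 2) (U : Lp -> Lp)
    (isoU : surjective_linear_isometry (V := LpOmega p_gt1) Romega U)
    (eps : R) (Uone : U one = eps *: one) k :
  exists2 phi : cube k -> cube k, bijective phi &
    forall f, U (J f) = eps *: (J (f \o phi) : Lp).
Proof.
have [h hE [psi psi_inj hpsi]] := iso_coordinate p_neq2 isoU k.
have [phi psiK phiK] := injF_bij psi_inj.
exists phi; first by exists psi.
have sum_h b : \sum_a 1 * h a b = eps.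
  apply: (Jn_inj (p_gt1 := p_gt1) (f := fun b => \sum_a 1 * h a b)
    (g := fun=> eps)).
  by rewrite -(iso_Jn_range isoU hE) Jn_cst -Uone Jn_cst scale1r.
have h0 a b : a != phi b -> h a b = 0.
  rewrite -{2}[b]phiK => /negPf ab.
  by apply/eqP/negPn; rewrite hpsi ab.
have h1 b : h (phi b) b = eps.
  rewrite -(sum_h b) (bigD1 (phi b))//= mul1r big1 ?addr0// => a ab.
  by rewrite h0// mulr0.
move=> f; rewrite (iso_Jn_range isoU hE).
(* [Jn_lin] applies to sums, hence the extra zero term. *)
rewrite -[RHS]addr0 -(Jn0 p_gt1 k) -Jn_lin; apply: Jn_ext => b.
rewrite addr0 (bigD1 (phi b))//= h1 big1 ?addr0 1?mulrC// => a ab.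
by rewrite h0// mulr0.
Qed.

End isometries.

Theorem corollary4p1 (R : realType) (p : R) (p_gt1 : 1 < p) (p_neq2 : p != 2)
    (U : LpOmega p_gt1 -> LpOmega p_gt1)
    (isoU : surjective_linear_isometry (@R_omega R p p_gt1) U) :
  exists (eps : R) (phi : forall k, cube k -> cube k),
    [/\ eps = -1 \/ eps = 1, forall k, bijective (phi k)
      & forall (c : R) (x : LpOmega p_gt1) (f : forall k, cube k -> R),
          exterior_decomposition x f ->
          let s := series (fun k => Jn p_gt1 (f k \o phi k)) in
          cvgn s /\
          U (c *: one_Omega p_gt1 + x) = (eps * c) *: one_Omega p_gt1 + eps *: limn s].
Proof.
have [eps epsE Uone] := iso_one p_neq2 isoU.
have h k := iso_bijection p_neq2 isoU Uone k.
exists eps, (fun k => s2val (cid2 (h k))); split => // [k|c x f [Xx _ fx] s].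
  exact: s2valP (cid2 (h k)).
have Rsub := R_omega_subspace p_gt1.
have eps2 : eps * eps = 1 by case: epsE => ->; ring.
have Rx : R_omega x by exists 0 => //; exists x => //; rewrite scale0r add0r.
pose t := series (fun k => Jn p_gt1 (f k)).
have Rt n : R_omega (t n).
  by apply: subspace_sum => // k; exact: R_omega_Jn.
have sE n : s n = eps *: U (t n).
  rewrite /s /t /series /= (iso_sum isoU) => [|k]; last exact: R_omega_Jn.
  rewrite scaler_sumr; apply: eq_bigr => k _.
  by rewrite (s2valP' (cid2 (h k))) scalerA eps2 scale1r.
have s_cvg : s @ \oo --> eps *: U x.
  apply/cvgrPdist_lt => e e0; move/cvgrPdist_lt : fx => /(_ e e0).
  apply: filterS => n; rewrite sE -scalerBr -(isoB isoU Rx (Rt n)) normrZ.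
  rewrite (iso_norm isoU); last exact: subspaceB.
  suff -> : `|eps| = 1 by rewrite mul1r.
  by case: epsE => ->; rewrite ?normrN normr1.
split; first by apply/cvg_ex; exists (eps *: U x).
have -> : limn s = eps *: U x by apply: cvg_lim.
rewrite scalerA eps2 scale1r (iso_lin isoU c (R_omega_one p_gt1) Rx) Uone.
by rewrite scalerA mulrC.
Qed.
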